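(* Let $N\ge 2$ be a fixed integer, let $R>0$ be given, and let $$b=\max\left\{\frac{\ln 4}{2\pi},\ \frac{4R\left(\sqrt{\pi}+\sqrt{2\pi}+24\pi^2R\exp(2\pi^{3/2}R)\right)}{\sqrt[N]{8^N+3^{N-1}}-8}\right\}.$$ Then there is a constant $A_R>0$ depending only on $R$ such that, for any two potentials $\mathrm q=[q_j]_{j=1}^N$ and $\tilde{\mathrm q}=[\tilde q_j]_{j=1}^N$ on the star-graph satisfying $$\omega_j=\tilde\omega_j,\quad j=1,\dots,N,\qquad \|\mathrm q\|<R,\qquad \|\tilde{\mathrm q}\|<R,$$ the corresponding Weyl vectors $\mathrm M$, $\tilde{\mathrm M}$ satisfy $$\|\mathrm M-\tilde{\mathrm M}\|_{L_2(\mathbb R+ib)}\le A_R\,\|\mathrm q-\tilde{\mathrm q}\|.$$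
   Context: Star-graph with $N$ edges of length $\pi$ ($N\ge2$ fixed). A potential is a vector function $\mathrm q=[q_j]_{j=1}^N$ with complex-valued $q_j\in L_2(0,\pi)$, with norm $\|\mathrm q\|=\max_{1\le j\le N}\|q_j\|_{L_2(0,\pi)}$. Put $\omega_j=\frac12\int_0^\pi q_j(t)\,dt$. For $\lambda\in\mathbb C$ consider the system $$-y_j''(x)+q_j(x)y_j(x)=\lambda y_j(x),\quad x\in(0,\pi),\ j=1,\dots,N,$$ with matching conditions $y_1(0)=y_j(\pi)$ for $j=2,\dots,N$ and $y_1'(0)=\sum_{j=2}^N y_j'(\pi)$. For $k=2,\dots,N$ the Weyl solution $\Phi_k(x,\lambda)=[\Phi_{jk}(x,\lambda)]_{j=1}^N$ is the solution of this system (including the matching conditions) satisfying $\Phi_{1k}(\pi,\lambda)=0$ and $\Phi_{jk}(0,\lambda)=\delta_{jk}$ for $j=2,\dots,N$ ($\delta_{jk}$ is the Kronecker delta). The Weyl functions are $M_k(\lambda)=\Phi_{kk}'(0,\lambda)$ (derivative in $x$), $k=2,\dots,N$; they are meromorphic in $\lambda$. The Weyl vector is $\mathrm M(\lambda)=[M_k(\lambda)]_{k=2}^N$. Objects with a tilde ($\tilde\omega_j$, $\tilde M_k$, $\tilde{\mathrm M}$) are the same objects constructed from $\tilde{\mathrm q}$. For $\tau>0$, $$\|\mathrm M-\tilde{\mathrm M}\|_{L_2(\mathbb R+i\tau)}:=\max_{2\le k\le N}\left(\int_{\mathbb R+i\tau}|M_k(\rho^2)-\tilde M_k(\rho^2)|^2\,d\rho\right)^{1/2}.$$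 *)

(* Defs.v *)
From HB Require Import structures.
From mathcomp Require Import all_boot all_order all_algebra.
From mathcomp Require Import all_classical all_reals all_analysis.
From mathcomp Require Export complex.

Set Implicit Arguments.
Unset Strict Implicit.
Unset Printing Implicit Defensive.

Import Order.TTheory GRing.Theory Num.Theory.
Import numFieldNormedType.Exports.

Local Open Scope classical_set_scope.
Local Open Scope ring_scope.

(* Edges of the star graph are labelled by 'I_N: edge j = 1, ..., N is
   the ordinal of value j - 1, so edge 1 is the ordinal of value 0 and the range
   j = 2, ..., N is the set of ordinals of nonzero value. *)

Section StarGraph.
Context {R : realType}.
Notation mu := (@lebesgue_measure R).

Definition cintegral (D : set R) (f : R -> R[i]) : R[i] :=
  Complex (Rintegral mu D (fun x => complex.Re (f x)))
          (Rintegral mu D (fun x => complex.Im (f x))).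

Definition cmeasurable_fun (D : set R) (f : R -> R[i]) : Prop :=
  measurable_fun D (fun x => complex.Re (f x)) /\ measurable_fun D (fun x => complex.Im (f x)).

Definition cintegrable (D : set R) (f : R -> R[i]) : Prop :=
  mu.-integrable D (fun x => (complex.Re (f x))%:E) /\
  mu.-integrable D (fun x => (complex.Im (f x))%:E).

Definition L2norm (D : set R) (f : R -> R[i]) : \bar R :=
  ((\int[mu]_(x in D) ((Normc.normc (f x)) ^+ 2)%:E) `^ (2^-1)%R)%E.

Definition inL2 (D : set R) (f : R -> R[i]) : Prop :=
  cmeasurable_fun D f /\ (L2norm D f < +oo)%E.

(* f is differentiable at x relatively to [0, pi] (one-sided at 0 and pi), with
   derivative d. *)
Definition has_derivative (f : R -> R[i]) (x : R) (d : R[i]) : Prop :=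
  ((fun t => (complex.Re (f t) - complex.Re (f x)) / (t - x))
     @ within `[0, pi] x^' --> complex.Re d) /\
  ((fun t => (complex.Im (f t) - complex.Im (f x)) / (t - x))
     @ within `[0, pi] x^' --> complex.Im d).

(* f is absolutely continuous on [0, pi], i.e. an indefinite Lebesgue integral,
   and its almost everywhere defined derivative is g. *)
Definition abs_continuous_with (f g : R -> R[i]) : Prop :=
  cintegrable `[0, pi] g /\
  forall x : R, 0 <= x <= pi -> f x = f 0 + cintegral `[0, x] g.

(* y solves - y'' + q y = lambda y on (0, pi) and dy is its derivative on
   [0, pi]: as q is only square integrable, y' is required to be absolutely
   continuous and the equation to hold almost everywhere. *)
Definition SL_solution (q : R -> R[i]) (lambda : R[i]) (y dy : R -> R[i]) :
    Prop :=
  (forall x : R, 0 <= x <= pi -> has_derivative y x (dy x)) /\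
  exists d2y : R -> R[i], abs_continuous_with dy d2y /\
    {ae mu, forall x : R, 0 < x < pi -> - d2y x + q x * y x = lambda * y x}.

Section Graph.
Context {N : nat}.
Implicit Types q y dy : 'I_N -> R -> R[i].

Definition potential q : Prop := forall j, inL2 `]0, pi[ (q j).

Definition potential_norm q : \bar R :=
  \big[maxe/0%E]_(j < N) L2norm `]0, pi[ (q j).

Definition omega q (j : 'I_N) : R[i] := 2^-1 * cintegral `]0, pi[ (q j).

Definition matching y dy : Prop :=
  forall r : 'I_N, val r = 0%N ->
    (forall j : 'I_N, val j != 0%N -> y r 0 = y j pi) /\
    dy r 0 = \sum_(j < N | val j != 0%N) dy j pi.

Definition graph_solution q (lambda : R[i]) y dy : Prop :=
  (forall j, SL_solution (q j) lambda (y j) (dy j)) /\ matching y dy.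

Definition weyl_solution q (k : 'I_N) (lambda : R[i]) y dy : Prop :=
  [/\ graph_solution q lambda y dy,
      forall r : 'I_N, val r = 0%N -> y r pi = 0 &
      forall j : 'I_N, val j != 0%N -> y j 0 = (j == k)%:R].

(* M_k(lambda) = Phi_kk'(0, lambda). The Weyl solution exists and is unique
   except for lambda in a discrete set, which contains the poles of M_k; there
   the value returned here is irrelevant. *)
Definition weyl_function q (k : 'I_N) (lambda : R[i]) : R[i] :=
  xget 0 [set m | exists y dy, weyl_solution q k lambda y dy /\ m = dy k 0].

(* The line R + i tau is parametrised by rho = x + i tau, so d rho = d x. *)
Definition weyl_dist (tau : R) q (qt : 'I_N -> R -> R[i]) : \bar R :=
  \big[maxe/0%E]_(k < N | val k != 0%N)
     L2norm setT (fun x : R =>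
       weyl_function q k (Complex x tau ^+ 2) -
       weyl_function qt k (Complex x tau ^+ 2)).

End Graph.

Definition line_height (N : nat) (r : R) : R :=
  Num.max (ln 4 / (2 * pi))
    (4 * r * (Num.sqrt pi + Num.sqrt (2 * pi)
              + 24 * pi ^+ 2 * r * expR (2 * pi `^ (3 / 2) * r))
     / ((8 ^+ N + 3 ^+ N.-1) `^ (N%:R^-1) - 8)).

End StarGraph.

(* Main.v *)
Require Import Defs.
From mathcomp Require Import all_boot all_order all_algebra.
From mathcomp Require Import all_classical all_reals all_analysis.
From mathcomp Require Import measurable_realfun.
From mathcomp Require Import ring lra.

(* Multiplying the equations of the two problems by each other's Weyl solutions and
   integrating over the graph gives
     M_k - Mt_k = sum_j int_0^pi (qt_j - q_j) Phi_jk Phit_jk dx.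
   On the line Im rho = b the Weyl solutions are bounded and differ by O(1/rho)
   from the Weyl solution of the zero potential: the waves y' - i rho y and
   y' + i rho y are damped along the edges by e^(-b x), a round trip on an edge
   costs the factor e^(-2 pi b) <= 1/4, and b >= 17 sqrt(pi) R makes the potential a
   contractive perturbation of the resulting scattering problem, which also yields
   existence by Picard iteration. The zero-potential solution is a combination of
   e^(i rho x) and e^(i rho (pi - x)); its square contributes Fourier integrals of
   qt_j - q_j, square integrable in rho by Bessel's inequality, and a constant, which
   the hypothesis omega_j = omegat_j annihilates. The O(1/rho) remainder is square
   integrable on the line. *)

Set Implicit Arguments.
Unset Strict Implicit.
Unset Printing Implicit Defensive.

Import Order.TTheory GRing.Theory Num.Theory.
Import numFieldNormedType.Exports.

Local Open Scope classical_set_scope.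
Local Open Scope ring_scope.

Local Notation Re := complex.Re.
Local Notation Im := complex.Im.
Local Notation normc := Normc.normc.
Local Notation AC := abs_continuous_with.

Section ComplexModulus.
Context {R : realType}.
Implicit Types (x y : R[i]) (a : R).

Lemma cReD x y : Re (x + y) = Re x + Re y. Proof. exact: raddfD. Qed.
Lemma cImD x y : Im (x + y) = Im x + Im y. Proof. exact: raddfD. Qed.
Lemma cReN x : Re (- x) = - Re x. Proof. exact: raddfN. Qed.
Lemma cImN x : Im (- x) = - Im x. Proof. exact: raddfN. Qed.
Lemma cReM x y : Re (x * y) = Re x * Re y - Im x * Im y.
Proof. by case: x; case: y. Qed.
Lemma cImM x y : Im (x * y) = Re x * Im y + Im x * Re y.
Proof. by case: x; case: y. Qed.

Definition cReImE := (cReD, cImD, cReN, cImN, cReM, cImM).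

Lemma complex_ext x y : Re x = Re y -> Im x = Im y -> x = y.
Proof. by case: x => a b; case: y => c d /= -> ->. Qed.

Lemma normc_ge0 x : 0 <= normc x.
Proof. exact: (@normr_ge0 _ (Rcomplex R)). Qed.

Lemma normc_le0 x : (normc x <= 0) = (x == 0).
Proof. exact: (@normr_le0 _ (Rcomplex R)). Qed.

Lemma normc_gt0 x : (0 < normc x) = (x != 0).
Proof. exact: (@normr_gt0 _ (Rcomplex R)). Qed.

Lemma sqr_normcE x : normc x ^+ 2 = Re x ^+ 2 + Im x ^+ 2.
Proof. by case: x => a b /=; rewrite sqr_sqrtr// addr_ge0// sqr_ge0. Qed.

Lemma ler_normcB x y : normc (x - y) <= normc x + normc y.
Proof. exact: (@ler_normB _ (Rcomplex R)). Qed.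

Lemma normc_distC x y : normc (x - y) = normc (y - x).
Proof. exact: (@distrC _ (Rcomplex R)). Qed.

Lemma lerB_normcD x y : normc x - normc y <= normc (x + y).
Proof. exact: (@lerB_normD _ (Rcomplex R)). Qed.

Lemma ler_dist_normc x y : `|normc x - normc y| <= normc (x - y).
Proof. exact: (@ler_dist_dist _ (Rcomplex R)). Qed.

Lemma ler_normc_sum I (s : seq I) (P : pred I) (F : I -> R[i]) :
  normc (\sum_(i <- s | P i) F i) <= \sum_(i <- s | P i) normc (F i).
Proof. exact: (@ler_norm_sum _ (Rcomplex R)). Qed.

Lemma ler_Re_normc x : `|Re x| <= normc x.
Proof. by rewrite -lecR; exact: normc_ge_Re. Qed.

Lemma ler_Im_normc x : `|Im x| <= normc x.
Proof. by rewrite -sqrtr_sqr; case: x => a b /=; rewrite ler_wsqrtr// lerDr sqr_ge0. Qed.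

Lemma normc_le_ReIm x : normc x <= `|Re x| + `|Im x|.
Proof.
rewrite -ler_sqr ?nnegrE ?normc_ge0 ?addr_ge0// sqr_normcE sqrrD.
by rewrite !real_normK ?num_real// lerD2r lerDl mulrn_wge0// mulr_ge0.
Qed.

Lemma conjcM x y : conjc (x * y) = conjc x * conjc y.
Proof. exact: rmorphM. Qed.

Lemma normc_conjc x : normc (conjc x) = normc x.
Proof. by case: x => a b /=; rewrite sqrrN. Qed.

Lemma normcX x n : normc (x ^+ n) = normc x ^+ n.
Proof.
by elim: n => [|n ih]; rewrite ?expr0 ?Normc.normc1// !exprS Normc.normcM ih.
Qed.

Lemma normc_real a : normc (Complex a 0) = `|a|.
Proof. by rewrite /= expr0n/= addr0 sqrtr_sqr. Qed.

Lemma normc_nat n : normc (n%:R : R[i]) = n%:R.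
Proof. by rewrite normcMn Normc.normc1. Qed.

Lemma sqr_normcB x y :
  normc (x - y) ^+ 2 = normc x ^+ 2 + normc y ^+ 2 - 2 * Re (conjc y * x).
Proof. by rewrite !sqr_normcE !cReImE; case: y => u v /=; ring. Qed.

End ComplexModulus.

#[local] Hint Extern 0 (is_true (@Order.le _ _ _ (Normc.normc _))) =>
  exact: normc_ge0 : core.

Section GeometricDecay.
Context {R : realType}.
Implicit Types (x C : R).

Lemma cvg_halving C : C / 2 ^+ n @[n --> \oo] --> (0 : R).
Proof.
have : `|2^-1| < 1 :> R by rewrite ger0_norm ?invr_ge0//; lra.
by move=> /(cvg_geometric C); under eq_cvg do rewrite /= exprVn.
Qed.

Lemma le0_halving x C : (forall n, x <= C / 2 ^+ n) -> x <= 0.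
Proof. by move=> xC; apply: (cvgr_to_ge (cvg_halving C)); exact: nearW. Qed.

Lemma cvg_dist_halving (u : nat -> R) l C :
  (forall n, `|l - u n| <= C / 2 ^+ n) -> u n @[n --> \oo] --> l.
Proof.
move=> uC; apply: (@squeeze_cvgr _ _ _ _ (fun n => l - C / 2 ^+ n)
  (fun n => l + C / 2 ^+ n)).
- by apply: nearW => n; have := uC n; rewrite ler_norml; lra.
- by rewrite -[X in _ --> X]subr0; apply: cvgB; [exact: cvg_cst|exact: cvg_halving].
- by rewrite -[X in _ --> X]addr0; apply: cvgD; [exact: cvg_cst|exact: cvg_halving].
Qed.

(* The sequences a n -+ 2 C / 2^n are adjacent. *)
Lemma halving_limit (a : nat -> R) C :
  (forall n, `|a n.+1 - a n| <= C / 2 ^+ n) ->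
  exists l, forall n, `|l - a n| <= 2 * C / 2 ^+ n.
Proof.
move=> aC.
pose lo n := a n - 2 * C / 2 ^+ n; pose up n := a n + 2 * C / 2 ^+ n.
have step n : 2 * C / 2 ^+ n = C / 2 ^+ n + 2 * C / 2 ^+ n.+1.
  by rewrite exprS; field; rewrite expf_neq0.
have lo_nd : nondecreasing_seq lo.
  apply/nondecreasing_seqP => n; have := aC n; have := step n.
  by rewrite /lo ler_norml; lra.
have up_ni : nonincreasing_seq up.
  apply/nonincreasing_seqP => n; have := aC n; have := step n.
  by rewrite /up ler_norml; lra.
have up_lo : (up - lo) n @[n --> \oo] --> 0.
  have -> : up - lo = fun n => 4 * C / 2 ^+ n.
    by apply/funext => n; rewrite /up /lo /= !fctE; ring.
  exact: cvg_halving.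
have [lim_eq lo_cvg up_cvg] := adjacent_seq lo_nd up_ni up_lo.
exists (limn lo) => n; rewrite ler_distl nondecreasing_cvgn_le//= -lim_eq.
exact: nonincreasing_cvgn_ge.
Qed.

Lemma complex_halving_limit (z : nat -> R[i]) C :
  (forall n, normc (z n.+1 - z n) <= C / 2 ^+ n) ->
  exists l, forall n, normc (l - z n) <= 4 * C / 2 ^+ n.
Proof.
move=> zC.
have [lr hr] : exists l, forall n, `|l - Re (z n)| <= 2 * C / 2 ^+ n.
  by apply: halving_limit => n; rewrite -raddfB/= (le_trans (ler_Re_normc _)).
have [li hi] : exists l, forall n, `|l - Im (z n)| <= 2 * C / 2 ^+ n.
  by apply: halving_limit => n; rewrite -raddfB/= (le_trans (ler_Im_normc _)).
exists (Complex lr li) => n; rewrite (le_trans (normc_le_ReIm _))// !raddfB/=.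
by have := hr n; have := hi n; lra.
Qed.

Lemma function_halving_limit {T : Type} (D : set T) (u : nat -> T -> R[i]) C :
  (forall n t, D t -> normc (u n.+1 t - u n t) <= C / 2 ^+ n) ->
  exists l, forall n t, D t -> normc (l t - u n t) <= 4 * C / 2 ^+ n.
Proof.
move=> uC; have lim t : exists l : R[i], D t -> forall n, normc (l - u n t) <= 4 * C / 2 ^+ n.
  have [Dt|] := pselect (D t); last by exists 0.
  by have [l ul] := complex_halving_limit (fun n => uC n t Dt); exists l.
by have [l ul] := choice lim; exists l => n t /ul.
Qed.

(* Halving the interval at the point where L takes its mean value halves the bound. *)
Lemma eq_of_sqr_increment {V : normedZmodType R} (a b : R) (L : R -> R) (h : R -> V) :
  {within `[a, b], continuous L} ->
  (forall x y, a <= x -> x <= y -> y <= b -> `|h y - h x| <= (L y - L x) ^+ 2) ->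
  a <= b -> h b = h a.
Proof.
move=> cL hL ab.
suff refined n x y : a <= x -> x <= y -> y <= b ->
    `|h y - h x| <= (L y - L x) ^+ 2 / 2 ^+ n.
  apply/eqP; rewrite -subr_eq0 -normr_le0.
  by apply: (@le0_halving _ ((L b - L a) ^+ 2)) => n; exact: refined.
elim: n x y => [|n ih] x y ax xy yb; first by rewrite expr0 divr1 hL.
have [] := @IVT R L x y ((L x + L y) / 2) xy.
- by apply: continuous_subspaceW cL => z /=; rewrite !in_itv/=; lra.
- by rewrite /Num.min /Num.max; case: ifP; lra.
move=> m; rewrite in_itv/= => /andP[xm my] Lm.
rewrite -(subrKA (h m)) (le_trans (ler_normD _ _))//.
have := ih _ _ ax xm (le_trans my yb); have := ih _ _ (le_trans ax xm) my yb.
have -> : (L y - L x) ^+ 2 / 2 ^+ n.+1 =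
    (L m - L x) ^+ 2 / 2 ^+ n + (L y - L m) ^+ 2 / 2 ^+ n.
  by rewrite Lm [2 ^+ n.+1]exprS; field; rewrite expf_neq0.
lra.
Qed.

End GeometricDecay.

Section ComplexMeasurability.
Context {R : realType}.
Implicit Types (D E : set (measurableTypeR R)) (f g : R -> R[i]).

Lemma cmeasurable_cst D (c : R[i]) : cmeasurable_fun D (fun=> c).
Proof. by split; exact: measurable_cst. Qed.

Lemma cmeasurableS D E f : measurable E -> D `<=` E ->
  cmeasurable_fun E f -> cmeasurable_fun D f.
Proof. by move=> mE DE [f1 f2]; split; exact: measurable_funS mE DE _. Qed.

Lemma cmeasurableD D f g : cmeasurable_fun D f -> cmeasurable_fun D g ->
  cmeasurable_fun D (fun x => f x + g x).
Proof.
by move=> [f1 f2] [g1 g2]; split;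
  [under eq_fun do rewrite cReD|under eq_fun do rewrite cImD];
  exact: measurable_funD.
Qed.

Lemma cmeasurableM D f g : cmeasurable_fun D f -> cmeasurable_fun D g ->
  cmeasurable_fun D (fun x => f x * g x).
Proof.
move=> [f1 f2] [g1 g2]; split.
- under eq_fun do rewrite cReM.
  by apply: measurable_funB; exact: measurable_funM.
- under eq_fun do rewrite cImM.
  by apply: measurable_funD; exact: measurable_funM.
Qed.

Lemma cmeasurableN D f : cmeasurable_fun D f -> cmeasurable_fun D (fun x => - f x).
Proof.
move=> /(cmeasurableM (cmeasurable_cst D (-1))).
by under eq_fun do rewrite mulN1r.
Qed.

Lemma cmeasurableB D f g : cmeasurable_fun D f -> cmeasurable_fun D g ->
  cmeasurable_fun D (fun x => f x - g x).
Proof. by move=> mf /cmeasurableN; exact: cmeasurableD. Qed.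

Lemma cmeasurable_conjc D f : cmeasurable_fun D f ->
  cmeasurable_fun D (fun x => conjc (f x)).
Proof.
have ReJ z : Re (conjc z) = Re z :> R by case: z.
have ImJ z : Im (conjc z) = - Im z :> R by case: z.
move=> [f1 f2]; split; first by under eq_fun do rewrite ReJ.
by under eq_fun do rewrite ImJ; exact: measurableT_comp.
Qed.

Lemma measurable_normc D f : cmeasurable_fun D f ->
  measurable_fun D (fun x => normc (f x)).
Proof.
move=> [f1 f2].
have -> : (fun x => normc (f x)) =
    Num.sqrt \o (fun x => Re (f x) ^+ 2 + Im (f x) ^+ 2).
  by apply/funext => x /=; case: (f x).
apply: (measurableT_comp (continuous_measurable_fun (@sqrt_continuous R))).
by apply: measurable_funD; exact: measurable_funX.
Qed.

Lemma measurable_sqr_normc D f : cmeasurable_fun D f ->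
  measurable_fun D (fun x => normc (f x) ^+ 2).
Proof. by move=> mf; apply: measurable_funX; exact: measurable_normc. Qed.

Lemma cmeasurable_halving_limit D (u : nat -> R -> R[i]) f (C : R) :
  (forall n, cmeasurable_fun D (u n)) ->
  (forall n x, D x -> normc (f x - u n x) <= C / 2 ^+ n) -> cmeasurable_fun D f.
Proof.
move=> mu uf; split; apply: measurable_fun_cvg => [n|x Dx].
- exact: (mu n).1.
- apply: (@cvg_dist_halving _ _ _ C) => n; apply: le_trans (uf n x Dx).
  by rewrite -raddfB; exact: ler_Re_normc.
- exact: (mu n).2.
- apply: (@cvg_dist_halving _ _ _ C) => n; apply: le_trans (uf n x Dx).
  by rewrite -raddfB; exact: ler_Im_normc.
Qed.

End ComplexMeasurability.

Section ComplexIntegral.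
Context {R : realType}.
Notation mu := (@lebesgue_measure R).
Implicit Types (D E : set (measurableTypeR R)) (f g : R -> R[i]) (h u v : R -> R).
Implicit Types (c : R[i]).

Definition L1norm D f : R := Rintegral mu D (fun x => normc (f x)).

Definition sqr_L2norm D f : R := Rintegral mu D (fun x => normc (f x) ^+ 2).

Definition normc_bounded D f (B : R) := forall x, D x -> normc (f x) <= B.

Lemma L1norm_ge0 D f : 0 <= L1norm D f.
Proof. by apply: Rintegral_ge0 => x _; exact: normc_ge0. Qed.

Lemma sqr_L2norm_ge0 D f : 0 <= sqr_L2norm D f.
Proof. by apply: Rintegral_ge0 => x _; exact: sqr_ge0. Qed.

Lemma eq_cintegral D f g : {in D, f =1 g} -> cintegral D f = cintegral D g.
Proof. by move=> fg; congr Complex; apply: eq_Rintegral => x /fg ->. Qed.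

Lemma cintegrable_measurable D f : cintegrable D f -> cmeasurable_fun D f.
Proof.
move=> [f1 f2]; split.
- by have /measurable_EFinP := measurable_int _ f1.
- by have /measurable_EFinP := measurable_int _ f2.
Qed.

Section MeasurableDomain.
Variable D : set (measurableTypeR R).
Hypothesis mD : measurable D.

Lemma integrable_EFinD u v :
  mu.-integrable D (EFin \o u) -> mu.-integrable D (EFin \o v) ->
  mu.-integrable D (EFin \o (fun x => u x + v x)).
Proof. by move=> ui vi; have := integrableD mD ui vi. Qed.

Lemma integrable_EFinZ (a : R) u : mu.-integrable D (EFin \o u) ->
  mu.-integrable D (EFin \o (fun x => a * u x)).
Proof. by move=> ui; have := integrableZl mD a ui. Qed.

Lemma eq_cintegrable f g : {in D, f =1 g} -> cintegrable D f -> cintegrable D g.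
Proof.
by move=> fg [f1 f2]; split;
  [apply: eq_integrable f1|apply: eq_integrable f2] => // x /fg /= ->.
Qed.

Lemma cintegrableS E f : measurable E -> D `<=` E -> cintegrable E f -> cintegrable D f.
Proof. by move=> mE DE [? ?]; split; apply: (integrableS mE). Qed.

Lemma cintegrable_normc f : cintegrable D f ->
  mu.-integrable D (EFin \o (fun x => normc (f x))).
Proof.
move=> fi; have [f1 f2] := fi.
apply: (@le_integrable _ _ _ _ _ mD _
  (fun x => `|(Re (f x))%:E| + `|(Im (f x))%:E|)%E).
- apply/measurable_EFinP.
  exact: measurable_normc (cintegrable_measurable fi).
- move=> x Dx /=; rewrite lee_fin ger0_norm//.
  by rewrite ger0_norm ?addr_ge0// normc_le_ReIm.
- by apply: integrableD => //; exact: integrable_abse.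
Qed.

Lemma cintegrable_le f h : cmeasurable_fun D f ->
  mu.-integrable D (EFin \o h) -> (forall x, D x -> normc (f x) <= h x) ->
  cintegrable D f.
Proof.
move=> [f1 f2] hi fh; split; apply: le_integrable hi => //;
  try exact/measurable_EFinP.
- move=> x Dx; rewrite /= lee_fin (le_trans (ler_Re_normc _))//.
  by rewrite (le_trans (fh _ Dx))// ler_norm.
- move=> x Dx; rewrite /= lee_fin (le_trans (ler_Im_normc _))//.
  by rewrite (le_trans (fh _ Dx))// ler_norm.
Qed.

Lemma cintegrableMl f g (B : R) : cmeasurable_fun D f -> normc_bounded D f B ->
  cintegrable D g -> cintegrable D (fun x => f x * g x).
Proof.
move=> mf fB gi; apply: (@cintegrable_le _ (fun x => B * normc (g x))).
- by apply: cmeasurableM => //; exact: cintegrable_measurable.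
- exact: integrable_EFinZ (cintegrable_normc gi).
- by move=> x Dx; rewrite Normc.normcM ler_wpM2r// fB.
Qed.

Lemma cintegrableMr f g (B : R) : cmeasurable_fun D g -> normc_bounded D g B ->
  cintegrable D f -> cintegrable D (fun x => f x * g x).
Proof.
move=> mg gB /(cintegrableMl mg gB).
by apply: eq_cintegrable => x _; exact: mulrC.
Qed.

Lemma cintegrableD f g : cintegrable D f -> cintegrable D g ->
  cintegrable D (fun x => f x + g x).
Proof.
move=> [f1 f2] [g1 g2]; split.
- by under eq_fun do rewrite cReD EFinD; exact: integrableD.
- by under eq_fun do rewrite cImD EFinD; exact: integrableD.
Qed.

Lemma cintegrableZ c f : cintegrable D f -> cintegrable D (fun x => c * f x).
Proof. by apply: (cintegrableMl (B := normc c) (cmeasurable_cst _ c)). Qed.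

Lemma cintegrableN f : cintegrable D f -> cintegrable D (fun x => - f x).
Proof. by move=> /(cintegrableZ (-1)); under eq_fun do rewrite mulN1r. Qed.

Lemma cintegrableB f g : cintegrable D f -> cintegrable D g ->
  cintegrable D (fun x => f x - g x).
Proof. by move=> fi /cintegrableN; exact: cintegrableD. Qed.

Lemma cintegralD f g : cintegrable D f -> cintegrable D g ->
  cintegral D (fun x => f x + g x) = cintegral D f + cintegral D g.
Proof.
move=> [f1 f2] [g1 g2]; apply: complex_ext; rewrite ?cReImE/=.
- by under eq_Rintegral do rewrite cReD; rewrite RintegralD.
- by under eq_Rintegral do rewrite cImD; rewrite RintegralD.
Qed.

Lemma cintegralZ c f : cintegrable D f ->
  cintegral D (fun x => c * f x) = c * cintegral D f.
Proof.
move=> [f1 f2]; apply: complex_ext; rewrite cReImE/=.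
- under eq_Rintegral do rewrite cReM.
  by rewrite RintegralB ?RintegralZl//; exact: integrable_EFinZ.
- under eq_Rintegral do rewrite cImM.
  by rewrite RintegralD ?RintegralZl//; exact: integrable_EFinZ.
Qed.

Lemma cintegralN f : cintegrable D f ->
  cintegral D (fun x => - f x) = - cintegral D f.
Proof.
by move=> fi; rewrite -mulN1r -cintegralZ//; under eq_fun do rewrite -mulN1r.
Qed.

Lemma cintegralB f g : cintegrable D f -> cintegrable D g ->
  cintegral D (fun x => f x - g x) = cintegral D f - cintegral D g.
Proof.
by move=> fi gi; rewrite cintegralD ?cintegralN//; exact: cintegrableN.
Qed.

Lemma cintegrable_conjc f : cintegrable D f -> cintegrable D (fun x => conjc (f x)).
Proof.
move=> fi; apply: cintegrable_le (cintegrable_normc fi) _.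
  by apply: cmeasurable_conjc; exact: cintegrable_measurable.
by move=> x _; rewrite normc_conjc.
Qed.

Lemma cintegral_conjc f : cintegrable D f ->
  cintegral D (fun x => conjc (f x)) = conjc (cintegral D f).
Proof.
move=> [_ f2]; congr Complex; first by apply: eq_Rintegral => x _; case: (f x).
rewrite -[RHS]mulN1r -RintegralZl//; apply: eq_Rintegral => x _.
by rewrite mulN1r; case: (f x).
Qed.

(* Rotate the integral onto the positive half-line: |w|^2 = Re (conj w * w). *)
Lemma le_normc_cintegral f : cintegrable D f -> normc (cintegral D f) <= L1norm D f.
Proof.
move=> fi; set w := cintegral D f.
have [->|w0] := eqVneq w 0; first by rewrite Normc.normc0 L1norm_ge0.
rewrite -(ler_pM2l (x := normc w)) ?normc_gt0// -expr2.
have -> : normc w ^+ 2 = Re (cintegral D (fun x => conjc w * f x)).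
  by rewrite cintegralZ// -/w sqr_normcE cReM; case: (w) => a b /=; ring.
rewrite -RintegralZl//; last exact: cintegrable_normc.
apply: le_Rintegral => //; first by have [] := cintegrableZ (conjc w) fi.
  by apply: integrable_EFinZ; exact: cintegrable_normc.
move=> x _; rewrite (le_trans (ler_norm _))// (le_trans (ler_Re_normc _))//.
by rewrite Normc.normcM normc_conjc.
Qed.

Lemma L1norm_le f h : cmeasurable_fun D f ->
  mu.-integrable D (EFin \o h) -> (forall x, D x -> normc (f x) <= h x) ->
  L1norm D f <= Rintegral mu D h.
Proof.
move=> mf hi fh; apply: le_Rintegral => //.
by apply: cintegrable_normc; exact: cintegrable_le fh.
Qed.

Lemma le_normc_cintegral_bound f h : cmeasurable_fun D f ->
  mu.-integrable D (EFin \o h) -> (forall x, D x -> normc (f x) <= h x) ->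
  normc (cintegral D f) <= Rintegral mu D h.
Proof.
move=> mf hi fh; apply: le_trans (L1norm_le mf hi fh).
by apply: le_normc_cintegral; exact: cintegrable_le fh.
Qed.

Lemma L1normMr_le f g (B : R) : cintegrable D f -> cmeasurable_fun D g ->
  normc_bounded D g B -> L1norm D (fun x => f x * g x) <= L1norm D f * B.
Proof.
move=> fi mg gB; rewrite mulrC -RintegralZl//; last exact: cintegrable_normc.
apply: L1norm_le; first by apply: cmeasurableM => //; exact: cintegrable_measurable.
  by apply: integrable_EFinZ; exact: cintegrable_normc.
by move=> x Dx; rewrite Normc.normcM mulrC ler_wpM2r// gB.
Qed.

Lemma ae_eq_integrable (u v : R -> \bar R) : measurable_fun D v -> ae_eq mu D u v ->
  mu.-integrable D u -> mu.-integrable D v.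
Proof.
move=> mv uv /integrableP[m_u ui]; apply/integrableP; split => //.
suff <- : (\int[mu]_(x in D) `|u x| = \int[mu]_(x in D) `|v x|)%E by [].
apply: ae_eq_integral => //.
- exact: measurableT_comp.
- exact: measurableT_comp.
- exact: ae_eq_abse.
Qed.

End MeasurableDomain.

Lemma L1norm_subset D E f : measurable D -> measurable E -> D `<=` E ->
  cintegrable E f -> L1norm D f <= L1norm E f.
Proof.
move=> mD mE DE fi; have ni : mu.-integrable E (EFin \o (fun x => normc (f x))).
  exact: cintegrable_normc.
apply: fine_le; first by apply: integrable_fin_num => //; exact: integrableS ni.
  exact: integrable_fin_num.
apply: ge0_subset_integral => //; first exact: measurable_int _ ni.
by move=> x _; rewrite lee_fin.
Qed.

Lemma ae_eq_cintegrable D f g : measurable D -> cmeasurable_fun D g ->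
  (\forall x \ae mu, D x -> f x = g x) -> cintegrable D f -> cintegrable D g.
Proof.
move=> mD [g1 g2] fg [f1 f2]; split.
- apply: ae_eq_integrable f1 => //; first exact/measurable_EFinP.
  by apply: filterS fg => x + Dx => /(_ Dx) ->.
- apply: ae_eq_integrable f2 => //; first exact/measurable_EFinP.
  by apply: filterS fg => x + Dx => /(_ Dx) ->.
Qed.

Lemma ae_eq_cintegral D f g : measurable D ->
  cmeasurable_fun D f -> cmeasurable_fun D g ->
  (\forall x \ae mu, D x -> f x = g x) -> cintegral D f = cintegral D g.
Proof.
move=> mD [f1 f2] [g1 g2] fg; congr Complex; congr fine; apply: ae_eq_integral => //;
  try exact/measurable_EFinP; by apply: filterS fg => x + Dx => /(_ Dx) ->.
Qed.

End ComplexIntegral.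

Section IntervalIntegral.
Context {R : realType}.
Notation mu := (@lebesgue_measure R).
Implicit Types (a b c : R) (f : R -> R[i]) (h : R -> R).

Lemma integrable_itv_cst a b (k : R) : mu.-integrable `[a, b] (EFin \o (fun=> k)).
Proof.
apply: continuous_compact_integrable; first exact: segment_compact.
by apply: continuous_subspaceT => x; exact: cst_continuous.
Qed.

Lemma Rintegral_itv_cst a b (k : R) : a <= b ->
  Rintegral mu `[a, b] (fun=> k) = k * (b - a).
Proof.
move=> ab; rewrite Rintegral_cst//= lebesgue_measure_itv/= lte_fin.
by case: ltgtP ab => [|//|->] _; rewrite ?subrr.
Qed.

Lemma continuous_integrable_itv h a b : continuous h ->
  mu.-integrable `[a, b] (EFin \o h).
Proof.
move=> ch; apply: continuous_compact_integrable; first exact: segment_compact.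
exact: continuous_subspaceT.
Qed.

Lemma cintegrable_bounded a b f (B : R) :
  cmeasurable_fun `[a, b] f -> normc_bounded `[a, b] f B -> cintegrable `[a, b] f.
Proof. by move=> mf; apply: cintegrable_le => //; exact: integrable_itv_cst. Qed.

Lemma sub_itvcc a b x y : a <= x -> y <= b -> `[x, y] `<=` `[a, b].
Proof. by move=> ax yb; apply: subset_itv; rewrite bnd_simp. Qed.

Lemma cintegrable_itvS a b x y f : a <= x -> y <= b ->
  cintegrable `[a, b] f -> cintegrable `[x, y] f.
Proof. by move=> ax yb; apply: cintegrableS => //; exact: sub_itvcc. Qed.

Lemma integrable_itvS a b x y h : a <= x -> y <= b ->
  mu.-integrable `[a, b] (EFin \o h) -> mu.-integrable `[x, y] (EFin \o h).
Proof. by move=> ax yb; apply: integrableS => //; exact: sub_itvcc. Qed.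

Lemma Rintegral_itv_split a b c h : a <= b -> b <= c ->
  mu.-integrable `[a, c] (EFin \o h) ->
  Rintegral mu `[a, c] h = Rintegral mu `[a, b] h + Rintegral mu `[b, c] h.
Proof.
move=> ab bc hi; have /= := @Rintegral_itvB R h (BLeft a) (BRight c) b hi.
rewrite !bnd_simp => /(_ ab bc).
rewrite Rintegral_itv_obnd_cbnd; first by move=> <-; rewrite addrC subrK.
by apply: integrableS hi => //; apply: subset_itv; rewrite bnd_simp.
Qed.

Lemma cintegral_itv_split a b c f : a <= b -> b <= c -> cintegrable `[a, c] f ->
  cintegral `[a, c] f = cintegral `[a, b] f + cintegral `[b, c] f.
Proof.
by move=> ab bc [f1 f2]; apply: complex_ext; rewrite cReImE/= (Rintegral_itv_split ab bc).
Qed.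

Lemma cintegral_itv1 a f : cintegral `[a, a] f = 0.
Proof. by rewrite /cintegral set_itv1 !Rintegral_set1. Qed.

Lemma cmeasurable_itv_oo_cc a b f :
  cmeasurable_fun `]a, b[ f -> cmeasurable_fun `[a, b] f.
Proof.
by move=> [f1 f2]; split;
  exact/measurable_fun_itv_obnd_cbndP/measurable_fun_itv_bndo_bndcP.
Qed.

Lemma cintegral_itv_oo_cc a b f : cintegrable `[a, b] f ->
  cintegral `]a, b[ f = cintegral `[a, b] f.
Proof.
move=> [f1 f2]; congr Complex; rewrite Rintegral_itv_bndo_bndc ?Rintegral_itv_obnd_cbnd//.
all: by [apply: integrableS f1 => //; apply: subset_itv; rewrite bnd_simp|
  apply: integrableS f2 => //; apply: subset_itv; rewrite bnd_simp].
Qed.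

End IntervalIntegral.

Section AbsolutelyContinuous.
Context {R : realType}.
Notation mu := (@lebesgue_measure R).
Implicit Types (f g h : R -> R[i]) (x y : R).

Definition ccontinuous (D : set R) f :=
  {within D, continuous (fun x => Re (f x))} /\
  {within D, continuous (fun x => Im (f x))}.

Lemma AC_increment f g x y : AC f g -> 0 <= x -> x <= y -> y <= pi ->
  f y - f x = cintegral `[x, y] g.
Proof.
move=> [gi fE] x0 xy ypi; rewrite fE; last lra.
rewrite [f x]fE; last lra.
rewrite (@cintegral_itv_split _ 0 x y)//; first ring.
exact: cintegrable_itvS gi.
Qed.

Lemma AC_increment_le f g a b x y : AC f g -> 0 <= a -> b <= pi ->
  a <= x -> x <= y -> y <= b -> normc (f y - f x) <= L1norm `[a, b] g.
Proof.
move=> fg a0 bpi ax xy yb; rewrite (AC_increment fg) ?(le_trans a0 ax) ?(le_trans yb bpi)//.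
have gi : cintegrable `[a, b] g by apply: cintegrable_itvS fg.1.
apply: (@le_trans _ _ (L1norm `[x, y] g)).
  by apply: le_normc_cintegral => //; exact: cintegrable_itvS gi.
by apply: L1norm_subset => //; exact: sub_itvcc.
Qed.

Lemma AC_bounded f g : AC f g ->
  normc_bounded `[0, pi] f (normc (f 0) + L1norm `[0, pi] g).
Proof.
move=> fg x /=; rewrite in_itv/= => /andP[x0 xpi].
rewrite -[f x](subrK (f 0)) addrC (le_trans (le_normcD _ _))// lerD2l.
exact: AC_increment_le fg _ _ _ _ _.
Qed.

Lemma AC_continuous f g : AC f g -> ccontinuous `[0, pi] f.
Proof.
move=> [[g1 g2] fE]; split.
- apply: (@subspace_eq_continuous _ _ _
      (fun x => Re (f 0) + Rintegral mu `[0, x] (fun t => Re (g t)))).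
    by move=> x; rewrite inE/= in_itv/= => /fE fx; rewrite /from_subspace/= fx cReD.
  move=> x; apply: cvgD; first exact: cvg_cst.
  exact: (parameterized_integral_continuous (pi_ge0 R) g1).
- apply: (@subspace_eq_continuous _ _ _
      (fun x => Im (f 0) + Rintegral mu `[0, x] (fun t => Im (g t)))).
    by move=> x; rewrite inE/= in_itv/= => /fE fx; rewrite /from_subspace/= fx cImD.
  move=> x; apply: cvgD; first exact: cvg_cst.
  exact: (parameterized_integral_continuous (pi_ge0 R) g2).
Qed.

Lemma AC_measurable f g : AC f g -> cmeasurable_fun `[0, pi] f.
Proof. by move=> /AC_continuous[? ?]; split; exact: subspace_continuous_measurable_fun. Qed.

Lemma AC_cintegrable f g : AC f g -> cintegrable `[0, pi] f.
Proof. by move=> fg; apply: cintegrable_bounded (AC_measurable fg) (AC_bounded fg). Qed.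

Lemma AC_cintegrableMl f g h : AC f g -> cintegrable `[0, pi] h ->
  cintegrable `[0, pi] (fun x => f x * h x).
Proof. by move=> fg; exact: cintegrableMl (AC_measurable fg) (AC_bounded fg). Qed.

Lemma AC_cintegrableMr f g h : AC f g -> cintegrable `[0, pi] h ->
  cintegrable `[0, pi] (fun x => h x * f x).
Proof. by move=> fg; exact: cintegrableMr (AC_measurable fg) (AC_bounded fg). Qed.

Lemma eq_AC f g f1 g1 : (forall x, 0 <= x <= pi -> f x = f1 x) ->
  (forall x, 0 <= x <= pi -> g x = g1 x) -> AC f g -> AC f1 g1.
Proof.
move=> ff gg [gi fE]; split.
  by apply: eq_cintegrable gi => // x; rewrite inE/= in_itv/= => /gg.
move=> x xpi; rewrite -!ff ?lexx ?pi_ge0// fE//; congr (_ + _).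
by apply: eq_cintegral => t; rewrite inE/= in_itv/= => tx; apply: gg; lra.
Qed.

Lemma AC_cst (c : R[i]) : AC (fun=> c) (fun=> 0).
Proof.
split; first by split; exact: integrable0.
by move=> x _; rewrite /cintegral/= !Rintegral_cst//= !mul0r addr0.
Qed.

Lemma AC_primitive f (c : R[i]) : cintegrable `[0, pi] f ->
  AC (fun x => c + cintegral `[0, x] f) f.
Proof. by move=> fi; split => // x _; rewrite cintegral_itv1 addr0. Qed.

Lemma AC_D f g f' g' : AC f f' -> AC g g' ->
  AC (fun x => f x + g x) (fun x => f' x + g' x).
Proof.
move=> [fi fE] [gi gE]; split; first exact: cintegrableD.
move=> x /[dup] /andP[_ xpi] x0pi; rewrite fE// gE// cintegralD//; first ring.
- exact: cintegrable_itvS fi.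
- exact: cintegrable_itvS gi.
Qed.

Lemma AC_Z (c : R[i]) f f' : AC f f' -> AC (fun x => c * f x) (fun x => c * f' x).
Proof.
move=> [fi fE]; split; first exact: cintegrableZ.
move=> x /[dup] /andP[_ xpi] x0pi; rewrite fE// cintegralZ//; first ring.
exact: cintegrable_itvS fi.
Qed.

Lemma AC_B f g f' g' : AC f f' -> AC g g' ->
  AC (fun x => f x - g x) (fun x => f' x - g' x).
Proof. by move=> ff /(AC_Z (-1)) /(AC_D ff); apply: eq_AC => x _; ring. Qed.

Lemma AC_M_cintegrable f g f' g' : AC f f' -> AC g g' ->
  cintegrable `[0, pi] (fun x => f' x * g x + f x * g' x).
Proof.
move=> ff gg; apply: cintegrableD => //; first exact: AC_cintegrableMr gg ff.1.
exact: AC_cintegrableMl ff gg.1.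
Qed.

Lemma AC_M_remainder_le f g f' g' x y : AC f f' -> AC g g' ->
  0 <= x -> x <= y -> y <= pi ->
  normc (f y * g y - f x * g x - cintegral `[x, y] (fun t => f' t * g t + f t * g' t)) <=
  (L1norm `[x, y] f' + L1norm `[x, y] g') ^+ 2.
Proof.
move=> ff gg x0 xy ypi; have sub := sub_itvcc x0 ypi.
have fi : cintegrable `[x, y] f' by apply: cintegrable_itvS ff.1.
have gi : cintegrable `[x, y] g' by apply: cintegrable_itvS gg.1.
pose Df t := f x - f t; pose Dg t := g y - g t.
have mDf : cmeasurable_fun `[x, y] Df.
  apply: cmeasurableB; first exact: cmeasurable_cst.
  by apply: cmeasurableS sub _ => //; exact: AC_measurable ff.
have mDg : cmeasurable_fun `[x, y] Dg.
  apply: cmeasurableB; first exact: cmeasurable_cst.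
  by apply: cmeasurableS sub _ => //; exact: AC_measurable gg.
have Dfb : normc_bounded `[x, y] Df (L1norm `[x, y] f').
  move=> t; rewrite /= in_itv/= => /andP[xt ty]; rewrite normc_distC.
  exact: AC_increment_le ff _ _ _ _ _.
have Dgb : normc_bounded `[x, y] Dg (L1norm `[x, y] g').
  by move=> t; rewrite /= in_itv/= => /andP[xt ty]; exact: AC_increment_le gg _ _ _ _ _.
have fDi := cintegrableMr (measurable_itv _) mDg Dgb fi.
have gDi := cintegrableMr (measurable_itv _) mDf Dfb gi.
have ki : cintegrable `[x, y] (fun t => f' t * g t + f t * g' t).
  by apply: cintegrable_itvS x0 ypi _; exact: AC_M_cintegrable.
have -> : f y * g y - f x * g x - cintegral `[x, y] (fun t => f' t * g t + f t * g' t) =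
    cintegral `[x, y] (fun t => f' t * Dg t) + cintegral `[x, y] (fun t => g' t * Df t).
  rewrite (_ : f y * g y - f x * g x = g y * (f y - f x) + f x * (g y - g x)); last ring.
  rewrite (AC_increment ff)// (AC_increment gg)// -!cintegralZ// -!cintegralD//.
  - rewrite -cintegralB//; last by apply: cintegrableD => //; exact: cintegrableZ.
    by apply: eq_cintegral => t _; rewrite /Df /Dg; ring.
  - exact: cintegrableZ.
  - exact: cintegrableZ.
have mI := measurable_itv `[x, y].
have fD_le := le_trans (le_normc_cintegral mI fDi) (L1normMr_le mI fi mDg Dgb).
have gD_le := le_trans (le_normc_cintegral mI gDi) (L1normMr_le mI gi mDf Dfb).
apply: (le_trans (le_normcD _ _)); apply: (le_trans (lerD fD_le gD_le)).
have := sqr_ge0 (L1norm `[x, y] f'); have := sqr_ge0 (L1norm `[x, y] g'); lra.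
Qed.

Lemma AC_M f g f' g' : AC f f' -> AC g g' ->
  AC (fun x => f x * g x) (fun x => f' x * g x + f x * g' x).
Proof.
move=> ff gg; have ki := AC_M_cintegrable ff gg.
pose k x := f' x * g x + f x * g' x.
split => // x /andP[x0 xpi].
pose l t := normc (f' t) + normc (g' t).
have nfi := cintegrable_normc (measurable_itv _) ff.1.
have ngi := cintegrable_normc (measurable_itv _) gg.1.
have li : mu.-integrable `[0, pi] (EFin \o l) by exact: integrable_EFinD.
pose L y := Rintegral mu `[0, y] l.
pose h y : Rcomplex R := f y * g y - cintegral `[0, y] k.
suff : h x = h 0 by rewrite /h cintegral_itv1 subr0 => /eqP; rewrite subr_eq => /eqP.
apply: (@eq_of_sqr_increment _ _ 0 x L) => //.
  by apply: parameterized_integral_continuous => //; exact: integrable_itvS li.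
move=> a b a0 ab bx; have bpi := le_trans bx xpi.
have -> : L b - L a = L1norm `[a, b] f' + L1norm `[a, b] g'.
  rewrite /L (@Rintegral_itv_split _ 0 a b)//; last exact: integrable_itvS li.
  rewrite addrAC subrr add0r RintegralD//; first exact: integrable_itvS nfi.
  exact: integrable_itvS ngi.
rewrite (_ : h b - h a = f b * g b - f a * g a - cintegral `[a, b] k).
  exact: AC_M_remainder_le.
rewrite /h (@cintegral_itv_split _ 0 a b)//; first ring.
exact: cintegrable_itvS ki.
Qed.

End AbsolutelyContinuous.

Section OneSidedDerivatives.
Context {R : realType}.
Notation mu := (@lebesgue_measure R).
Implicit Types (D E : set R) (F G : R -> R) (a b d x t : R).

Definition tangent_within D F x d := forall e : R, 0 < e ->
  \forall t \near x, D t -> `|F t - F x - d * (t - x)| <= e * `|t - x|.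

Lemma dist_quotient F x d t : t != x ->
  `|d - (F t - F x) / (t - x)| = `|F t - F x - d * (t - x)| / `|t - x|.
Proof.
move=> tx; rewrite -normfV -normrM -normrN; congr `|_|.
by field; rewrite subr_eq0.
Qed.

Lemma difference_quotientP D F x d :
  ((fun t => (F t - F x) / (t - x)) @ within D x^' --> d) <-> tangent_within D F x d.
Proof.
split=> [/cvgrPdist_le Fd e e0|Fd].
- have := Fd e e0; rewrite !near_withinE; apply: filterS => t Ft Dt.
  have [->|tx] := eqVneq t x; first by rewrite !subrr mulr0 subr0 normr0 mulr0.
  by rewrite -ler_pdivrMr ?normr_gt0 ?subr_eq0// -dist_quotient// Ft.
- apply/cvgrPdist_le => e e0; rewrite !near_withinE.
  apply: filterS (Fd e e0) => t Ft tx Dt.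
  by rewrite dist_quotient// ler_pdivrMr ?normr_gt0 ?subr_eq0// Ft.
Qed.

Lemma tangent_withinS D E F x d : D `<=` E ->
  tangent_within E F x d -> tangent_within D F x d.
Proof. by move=> DE Fd e /Fd; apply: filterS => t Ft /DE. Qed.

Lemma tangent_interior D F x d : nbhs x D ->
  tangent_within D F x d -> tangent_within setT F x d.
Proof. by move=> xD Fd e /Fd; apply: filterS2 xD => t Dt /(_ Dt). Qed.

Lemma is_derive_tangentP F x d : is_derive x 1 F d <-> tangent_within setT F x d.
Proof.
have quot (h : R) : h^-1 *: ((F \o shift x) (h *: (1 : R)) - F x) =
    (F (h + x) - F x) / ((h + x) - x).
  by rewrite /= [h *: 1]mulr1 addrK [RHS]mulrC.
have shifted (e : R) :
    (\forall h \near 0^', `|d - h^-1 *: ((F \o shift x) (h *: (1 : R)) - F x)| <= e) <->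
    (\forall t \near within setT x^', `|d - (F t - F x) / (t - x)| <= e).
  have neq h : (h + x != x) = (h != 0) by rewrite -subr_eq0 addrK.
  rewrite !near_withinE [X in _ <-> X](near_shift 0 x) subr0.
  by split; apply: filterS => h; rewrite /= -/(shift x h) quot neq => hd h0 *; exact: hd.
rewrite -difference_quotientP; split.
- move=> [dF Fd]; apply/cvgrPdist_le => e e0; apply/shifted.
  by apply: cvgr_dist_le e0; rewrite -Fd; exact: dF.
- move=> /cvgrPdist_le Fd.
  have Fd' : (fun h => h^-1 *: ((F \o shift x) (h *: (1 : R)) - F x)) @ 0^' --> d.
    by apply/cvgrPdist_le => e /Fd/shifted.
  by apply: DeriveDef; [apply/cvg_ex; exists d|exact/cvg_lim].
Qed.

Lemma tangent_continuous D F x d : tangent_within D F x d ->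
  F t @[t --> within D (nbhs x)] --> F x.
Proof.
move=> Fd; apply/cvgrPdist_le => e e0; rewrite near_withinE.
have K0 : 0 < 1 + `|d| by rewrite ltr_wpDr.
near=> t => Dt; rewrite distrC -(subrK (d * (t - x)) (F t - F x)).
rewrite (le_trans (ler_normD _ _))// normrM.
have Ft : `|F t - F x - d * (t - x)| <= 1 * `|t - x|.
  by move: Dt; near: t; exact: Fd.
have tx : (1 + `|d|) * `|t - x| <= e.
  rewrite mulrC -ler_pdivlMr// distrC ltW//; near: t; apply: cvgr_dist_lt => //.
  by rewrite divr_gt0.
by lra.
Unshelve. all: by end_near. Qed.

Lemma tangent_FTC2 F G a b : a <= b ->
  (forall x, a <= x <= b -> tangent_within `[a, b] F x (G x)) ->
  {within `[a, b], continuous G} -> F b - F a = Rintegral mu `[a, b] G.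
Proof.
rewrite le_eqVlt => /predU1P[-> _ _|ab Fd cG].
  by rewrite subrr set_itv1 Rintegral_set1.
have dF x : x \in `]a, b[ -> is_derive x 1 F (G x).
  rewrite in_itv/= => /andP[ax xb]; apply/is_derive_tangentP.
  apply: tangent_interior (Fd x _); last by rewrite !ltW.
  by apply: (filterS (@subset_itv_oo_cc _ _ a b)); apply: near_in_itvoo; rewrite in_itv/= ax.
have : {within `[a, b], continuous F}.
  by apply/subspace_continuousP => x /=; rewrite in_itv/= => /Fd; exact: tangent_continuous.
move=> /(continuous_within_itvP _ ab)[_ Fa Fb].
rewrite /Rintegral (@continuous_FTC2 R G F a b ab cG)//.
- by split => // x /dF [].
- by move=> x /dF [_ <-]; rewrite derive1E.
Qed.

Lemma Rintegral_near_cst G a b c e : a <= b ->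
  mu.-integrable `[a, b] (EFin \o G) ->
  (forall t, a <= t <= b -> `|G t - c| <= e) ->
  `|Rintegral mu `[a, b] G - c * (b - a)| <= e * (b - a).
Proof.
move=> ab Gi Gc; rewrite -!Rintegral_itv_cst// -RintegralB//; last exact: integrable_itv_cst.
have Gci : mu.-integrable `[a, b] (EFin \o (fun t => G t - c)).
  by apply: integrable_EFinD => //; exact: integrable_itv_cst.
apply: (le_trans (le_normr_Rintegral _ Gci)) => //.
apply: le_Rintegral => //; [exact: integrable_norm Gci|exact: integrable_itv_cst].
Qed.

Lemma primitive_tangent F G a b x :
  (forall s t, a <= s -> s <= t -> t <= b -> F t - F s = Rintegral mu `[s, t] G) ->
  mu.-integrable `[a, b] (EFin \o G) -> {within `[a, b], continuous G} ->
  a <= x <= b -> tangent_within `[a, b] F x (G x).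
Proof.
move=> FG Gi /subspace_continuousP cG xab e e0.
have := cG x xab => /cvgrPdist_le/(_ e e0); rewrite near_withinE => /nbhs_ballP[r /= r0 Gx].
apply/nbhs_ballP; exists r => // t xt; rewrite /= in_itv/= => tab.
have near_x s : a <= s <= b -> `|s - x| <= `|t - x| -> `|G s - G x| <= e.
  move=> sab sx; rewrite distrC; apply: Gx => //.
  by rewrite /ball/= distrC (le_lt_trans sx)// distrC.
have [xt_le|tx] := leP x t.
- rewrite FG ?[`|t - x|]ger0_norm ?subr_ge0//; try lra.
  apply: Rintegral_near_cst => //; first by apply: integrable_itvS Gi; lra.
  by move=> s sxt; apply: near_x; [lra|rewrite !ger0_norm ?subr_ge0//; lra].
- have -> : F t - F x - G x * (t - x) = - (F x - F t - G x * (x - t)) by ring.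
  rewrite normrN [`|t - x|]distrC FG ?[`|x - t|]gtr0_norm ?subr_gt0//; try lra.
  apply: Rintegral_near_cst; [lra|by apply: integrable_itvS Gi; lra|].
  by move=> s sxt; apply: near_x; [lra|rewrite !ler0_norm ?subr_le0//; lra].
Qed.

End OneSidedDerivatives.

Section SturmLiouville.
Context {R : realType}.
Notation mu := (@lebesgue_measure R).
Implicit Types (f g h q y dy : R -> R[i]) (x : R) (lambda : R[i]).

Lemma AC_has_derivative f g x : AC f g -> ccontinuous `[0, pi] g ->
  0 <= x <= pi -> has_derivative f x (g x).
Proof.
move=> fg [cg1 cg2] xpi; have [[g1 g2] _] := fg.
split; apply/difference_quotientP.
- apply: (primitive_tangent (F := fun t => Re (f t))) g1 cg1 xpi => s t s0 st tpi.
  by rewrite -raddfB/= (AC_increment fg).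
- apply: (primitive_tangent (F := fun t => Im (f t))) g2 cg2 xpi => s t s0 st tpi.
  by rewrite -raddfB/= (AC_increment fg).
Qed.

Lemma has_derivative_AC f g : (forall x, 0 <= x <= pi -> has_derivative f x (g x)) ->
  ccontinuous `[0, pi] g -> AC f g.
Proof.
move=> fg [cg1 cg2]; split.
  by split; apply: continuous_compact_integrable => //; exact: segment_compact.
move=> x /andP[x0 xpi]; have sub := sub_itvcc (lexx 0) xpi.
apply/eqP; rewrite addrC -subr_eq; apply/eqP/complex_ext; rewrite raddfB/=.
- apply: (tangent_FTC2 (F := fun t => Re (f t))) => // [t /andP[t0 tx]|].
    apply: tangent_withinS sub _; apply/difference_quotientP.
    by have [] := fg t (introT andP (conj t0 (le_trans tx xpi))).
  exact: continuous_subspaceW sub cg1.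
- apply: (tangent_FTC2 (F := fun t => Im (f t))) => // [t /andP[t0 tx]|].
    apply: tangent_withinS sub _; apply/difference_quotientP.
    by have [] := fg t (introT andP (conj t0 (le_trans tx xpi))).
  exact: continuous_subspaceW sub cg2.
Qed.

Lemma ae_itv_oo_cc (a b : R) (P : R -> Prop) :
  {ae mu, forall x, a < x < b -> P x} -> \forall x \ae mu, `[a, b]%classic x -> P x.
Proof.
have ae_neq (c : R) : \forall x \ae mu, x <> c.
  exists [set c]; split => //; first exact: lebesgue_measure_set1.
  by move=> x /=; rewrite not_notE.
move=> Poo; apply: (@filterS3 _ _ (ae_filter_ringOfSetsType mu) _ _ _ _ _
  Poo (ae_neq a) (ae_neq b)) => x Px xa xb.
move=> /=; rewrite in_itv/= => xab; apply: Px.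
by move/eqP: xa; move/eqP: xb; rewrite !neq_lt; lra.
Qed.

Lemma AC_ae f g h : AC f g -> cmeasurable_fun `[0, pi] h ->
  {ae mu, forall x, 0 < x < pi -> g x = h x} -> AC f h.
Proof.
move=> [gi fE] mh /ae_itv_oo_cc gh; split; first exact: ae_eq_cintegrable gi.
move=> x /[dup] /andP[x0 xpi] /fE ->; congr (_ + _).
have sub := sub_itvcc (lexx 0) xpi.
apply: ae_eq_cintegral => //.
- by apply: cmeasurableS sub _ => //; exact: cintegrable_measurable.
- exact: cmeasurableS sub mh.
- by apply: filterS gh => [|t + /sub//]; exact: (ae_filter_ringOfSetsType mu).
Qed.

Lemma SL_solutionP q lambda y dy : cmeasurable_fun `[0, pi] q ->
  SL_solution q lambda y dy <-> AC y dy /\ AC dy (fun x => (q x - lambda) * y x).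
Proof.
move=> mq; split=> [[y_dy [d2y [dy_d2y eqn]]]|[acy acdy]].
- have acy := has_derivative_AC y_dy (AC_continuous dy_d2y); split => //.
  apply: AC_ae dy_d2y _ _.
    apply: cmeasurableM (AC_measurable acy).
    by apply: cmeasurableB => //; exact: cmeasurable_cst.
  apply: filterS eqn => [|x]; first exact: (ae_filter_ringOfSetsType mu).
  by move=> + xpi => /(_ xpi); rewrite mulrBl => <-; ring.
- split; first by move=> x; exact: AC_has_derivative acy (AC_continuous acdy).
  by exists (fun x => (q x - lambda) * y x); split => //; apply: aeW => x _; ring.
Qed.

End SturmLiouville.

Section ComplexExponential.
Context {R : realType}.
Implicit Types (c d : R[i]) (x y : R).

Definition cexp c x : R[i] :=
  Complex (expR (Re c * x) * cos (Im c * x)) (expR (Re c * x) * sin (Im c * x)).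

Lemma cexp0 c : cexp c 0 = 1.
Proof. by rewrite /cexp !mulr0 expR0 cos0 sin0 !mul1r. Qed.

Lemma cexp0l x : cexp 0 x = 1.
Proof. by rewrite /cexp/= !mul0r expR0 cos0 sin0 !mul1r. Qed.

Lemma cexpD c x y : cexp c (x + y) = cexp c x * cexp c y.
Proof. by apply: complex_ext; rewrite cReImE/= !mulrDr expRD ?cosD ?sinD; ring. Qed.

Lemma cexpDl c d x : cexp (c + d) x = cexp c x * cexp d x.
Proof.
by apply: complex_ext; rewrite cReImE/= cReD cImD !mulrDl expRD ?cosD ?sinD; ring.
Qed.

Lemma cexpNl c x : cexp (- c) x = cexp c (- x).
Proof. by rewrite /cexp !cReImE !mulrN !mulNr. Qed.

Lemma cexpK c x : cexp c x * cexp (- c) x = 1.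
Proof. by rewrite cexpNl -cexpD subrr cexp0. Qed.

Lemma normc_cexp c x : normc (cexp c x) = expR (Re c * x).
Proof.
apply/eqP; rewrite -(eqrXn2 (n := 2)) ?expR_ge0// sqr_normcE/= !exprMn -mulrDr.
by rewrite cos2Dsin2 mulr1.
Qed.

Lemma normc_cexp_le1 c x : Re c * x <= 0 -> normc (cexp c x) <= 1.
Proof. by move=> cx; rewrite normc_cexp -expR0 ler_expR. Qed.

Lemma cexp_has_derivative c x : has_derivative (cexp c) x (c * cexp c x).
Proof.
have linear_derive (a : R) : is_derive x 1 (fun t => a * t) a.
  have -> : (fun t => a * t) = (a \*: (@id R)) by [].
  by apply: is_derive_eq; rewrite /GRing.scale/= mulr1.
have exp_derive : is_derive x 1 (expR \o (fun t => Re c * t)) (expR (Re c * x) * Re c).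
  exact: is_derive1_comp.
have cos_derive : is_derive x 1 (cos \o (fun t => Im c * t)) (- sin (Im c * x) * Im c).
  exact: is_derive1_comp.
have sin_derive : is_derive x 1 (sin \o (fun t => Im c * t)) (cos (Im c * x) * Im c).
  exact: is_derive1_comp.
split; apply/difference_quotientP; apply: (tangent_withinS (@subsetT _ _)).
- apply/is_derive_tangentP.
  have -> : (fun t => Re (cexp c t)) =
    (expR \o (fun t => Re c * t)) * (cos \o (fun t => Im c * t)) by [].
  by apply: is_derive_eq; rewrite cReM /GRing.scale/=; ring.
- apply/is_derive_tangentP.
  have -> : (fun t => Im (cexp c t)) =
    (expR \o (fun t => Re c * t)) * (sin \o (fun t => Im c * t)) by [].
  by apply: is_derive_eq; rewrite cImM /GRing.scale/=; ring.
Qed.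

Lemma continuous_cexp c :
  continuous (fun x => Re (cexp c x)) /\ continuous (fun x => Im (cexp c x)).
Proof.
have lin (a : R) : continuous (fun t : R => a * t) by exact: mulrl_continuous.
have comp_lin (f : R -> R) (a : R) : continuous f -> continuous (fun t => f (a * t)).
  by move=> cf x; apply: continuous_comp; [exact: lin|exact: cf].
have exp_cont := comp_lin _ (Re c) (@continuous_expR R).
have cos_cont := comp_lin _ (Im c) (@continuous_cos R).
have sin_cont := comp_lin _ (Im c) (@continuous_sin R).
by split=> x; apply: cvgM; first [exact: exp_cont|exact: cos_cont|exact: sin_cont].
Qed.

Lemma AC_cexp c : AC (cexp c) (fun x => c * cexp c x).
Proof.
apply: has_derivative_AC => [x _|]; first exact: cexp_has_derivative.
have [re_cont im_cont] := continuous_cexp c.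
split; apply: continuous_subspaceT => x.
- under eq_fun do rewrite cReM.
  by apply: cvgB; apply: cvgM; first [exact: cvg_cst|exact: re_cont|exact: im_cont].
- under eq_fun do rewrite cImM.
  by apply: cvgD; apply: cvgM; first [exact: cvg_cst|exact: re_cont|exact: im_cont].
Qed.

End ComplexExponential.

Section Edge.
Context {R : realType}.
Implicit Types (c d : R[i]) (f w y dy : R -> R[i]) (x z : R).

(* With c = i rho and lambda = - c^2 = rho^2, the waves dy + c y, which travels from
   0 to pi, and dy - c y, which travels from pi to 0, decouple y'' = c^2 y + f. *)
Definition edge_solution c f y dy :=
  AC y dy /\ AC dy (fun x => c ^+ 2 * y x + f x).

Definition rwave c y dy x := dy x + c * y x.

Definition lwave c y dy x := dy x - c * y x.

Lemma SL_edge_solutionP c (q : R -> R[i]) y dy : cmeasurable_fun `[0, pi] q ->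
  SL_solution q (- c ^+ 2) y dy <-> edge_solution c (fun x => q x * y x) y dy.
Proof.
move=> mq; rewrite SL_solutionP//; split=> -[acy acdy]; split => //;
by apply: eq_AC acdy => // x _; ring.
Qed.

Lemma edge_solution_integrable c f y dy : edge_solution c f y dy ->
  cintegrable `[0, pi] f.
Proof.
move=> [acy [di _]].
apply: (@eq_cintegrable _ _ _ (fun x => (c ^+ 2 * y x + f x) - c ^+ 2 * y x)) => //.
  by move=> x _; ring.
by apply: cintegrableB => //; apply: cintegrableZ => //; exact: AC_cintegrable acy.
Qed.

Lemma AC_rwave c f y dy : edge_solution c f y dy ->
  AC (rwave c y dy) (fun x => c * rwave c y dy x + f x).
Proof.
move=> [acy acdy]; apply: eq_AC (AC_D acdy (AC_Z c acy)) => x _ //.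
by rewrite /rwave; ring.
Qed.

Lemma AC_lwave c f y dy : edge_solution c f y dy ->
  AC (lwave c y dy) (fun x => - c * lwave c y dy x + f x).
Proof.
move=> [acy acdy]; apply: eq_AC (AC_B acdy (AC_Z c acy)) => x _ //.
by rewrite /lwave; ring.
Qed.

Lemma AC_duhamel d f w a b : AC w (fun x => d * w x + f x) ->
  0 <= a -> a <= b -> b <= pi ->
  cexp (- d) b * w b - cexp (- d) a * w a = cintegral `[a, b] (fun t => cexp (- d) t * f t).
Proof.
move=> acw a0 ab bpi; have acm := AC_M (AC_cexp (- d)) acw.
by rewrite (AC_increment acm)//; apply: eq_cintegral => t _; ring.
Qed.

Lemma AC_duhamel_le d f w a b z : AC w (fun x => d * w x + f x) ->
  cintegrable `[0, pi] f -> 0 <= a -> a <= b -> b <= pi ->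
  (forall t, a <= t <= b -> Re d * (z - t) <= 0) ->
  normc (cexp d (z - b) * w b - cexp d (z - a) * w a) <= L1norm `[0, pi] f.
Proof.
move=> acw fi a0 ab bpi dz; have fi' := cintegrable_itvS a0 bpi fi.
have ei : cintegrable `[a, b] (fun t => cexp (- d) t * f t).
  by apply: cintegrable_itvS a0 bpi _; exact: AC_cintegrableMl (AC_cexp _) fi.
have -> : cexp d (z - b) * w b - cexp d (z - a) * w a =
    cintegral `[a, b] (fun t => cexp d z * (cexp (- d) t * f t)).
  rewrite cintegralZ// -(AC_duhamel acw)// mulrBr !mulrA.
  by rewrite [cexp d (z - b)]cexpD [cexp d (z - a)]cexpD -!cexpNl.
apply: (@le_trans _ _ (L1norm `[a, b] f)); last by apply: L1norm_subset => //; exact: sub_itvcc.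
apply: le_normc_cintegral_bound => //.
- by apply: cintegrable_measurable; exact: cintegrableZ.
- exact: cintegrable_normc.
- move=> t /=; rewrite in_itv/= => tab.
  rewrite mulrA Normc.normcM ler_piMl// cexpNl -cexpD; apply: normc_cexp_le1; exact: dz.
Qed.

Lemma rwave_le c f y dy x : edge_solution c f y dy -> Re c <= 0 -> 0 <= x <= pi ->
  normc (rwave c y dy x - cexp c x * rwave c y dy 0) <= L1norm `[0, pi] f.
Proof.
move=> es c0 /andP[x0 xpi].
have := AC_duhamel_le (AC_rwave es) (edge_solution_integrable es) (lexx 0) x0 xpi.
by move=> /(_ x); rewrite subrr cexp0 mul1r subr0; apply => t tx; nra.
Qed.

Lemma lwave_le c f y dy x : edge_solution c f y dy -> Re c <= 0 -> 0 <= x <= pi ->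
  normc (lwave c y dy x - cexp c (pi - x) * lwave c y dy pi) <= L1norm `[0, pi] f.
Proof.
move=> es c0 /andP[x0 xpi].
have := AC_duhamel_le (AC_lwave es) (edge_solution_integrable es) x0 xpi (lexx pi).
move=> /(_ x); rewrite subrr cexp0 mul1r cexpNl opprB normc_distC; apply => t tx.
by rewrite cReN; nra.
Qed.

Lemma first_order_exists d f (w0 : R[i]) : cintegrable `[0, pi] f ->
  exists w, [/\ AC w (fun x => d * w x + f x), w 0 = w0 &
    w pi = cexp d pi * (w0 + cintegral `[0, pi] (fun t => cexp (- d) t * f t))].
Proof.
move=> fi; pose F x := w0 + cintegral `[0, x] (fun t => cexp (- d) t * f t).
have acF : AC F (fun t => cexp (- d) t * f t).
  by apply: AC_primitive; exact: AC_cintegrableMl (AC_cexp _) fi.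
exists (fun x => cexp d x * F x); split => //; last first.
  by rewrite cexp0 mul1r /F cintegral_itv1 addr0.
apply: eq_AC (AC_M (AC_cexp d) acF) => // x _.
by rewrite -mulrA [cexp d x * (_ * f x)]mulrA cexpK mul1r.
Qed.

Lemma edge_solution_of_waves c f u v : c != 0 ->
  AC u (fun x => - c * u x + f x) -> AC v (fun x => c * v x + f x) ->
  exists y dy, [/\ edge_solution c f y dy, lwave c y dy =1 u & rwave c y dy =1 v].
Proof.
move=> c0 acu acv.
exists (fun x => (2 * c)^-1 * (v x - u x)), (fun x => 2^-1 * (u x + v x)).
split; first split.
- by apply: eq_AC (AC_Z (2 * c)^-1 (AC_B acv acu)) => // x _; field; rewrite c0.
- by apply: eq_AC (AC_Z 2^-1 (AC_D acu acv)) => // x _; field; rewrite c0.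
- by move=> x; rewrite /lwave; field; rewrite c0.
- by move=> x; rewrite /rwave; field; rewrite c0.
Qed.

Lemma edge_solution_exists c f : c != 0 -> cintegrable `[0, pi] f ->
  exists A B : R[i], forall U V : R[i], exists y dy,
    [/\ edge_solution c f y dy, lwave c y dy pi = U, rwave c y dy 0 = V,
        lwave c y dy 0 = cexp c pi * U - A & rwave c y dy pi = cexp c pi * V + B].
Proof.
move=> c0 fi; pose A := cintegral `[0, pi] (fun t => cexp c t * f t).
exists A, (cexp c pi * cintegral `[0, pi] (fun t => cexp (- c) t * f t)) => U V.
have [u [acu u0 upi]] := first_order_exists (- c) (cexp c pi * U - A) fi.
have [v [acv v0 vpi]] := first_order_exists c V fi.
have [y [dy [es lw rw]]] := edge_solution_of_waves c0 acu acv.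
exists y, dy; split; rewrite ?lw ?rw//; last by rewrite vpi mulrDr.
by rewrite upi opprK subrK mulrA [cexp (- c) _ * _]mulrC cexpK mul1r.
Qed.

End Edge.

(* At the inner vertex of a star, o j and i j are the amplitudes of the outgoing and of
   the incoming wave on the edge j; p j and m j are those at its outer end, where p j
   travels back to the vertex. Travelling along an edge costs the factor E. *)
Section StarScattering.
Context {R : realType} {I : finType}.
Implicit Types (z E W : R[i]) (o i p m a : I -> R[i]) (s H K : R).

Lemma normc_1D_ge z : normc z <= 1 / 4 -> 3 / 4 <= normc (1 + z).
Proof. by have := lerB_normcD 1 z; rewrite Normc.normc1; lra. Qed.

Lemma normc_sqr_le_quarter z : normc z <= 1 / 2 -> normc (z ^+ 2) <= 1 / 4.
Proof. by rewrite normcX; have := normc_ge0 z; nra. Qed.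

Lemma sum_incoming o i W : (forall j, i j - o j = 2 * W) -> \sum_j (o j + i j) = 0 ->
  \sum_j i j = #|I|%:R * W /\ \sum_j o j = - (#|I|%:R * W).
Proof.
move=> iow; rewrite big_split/= => /eqP; rewrite addr_eq0 => /eqP sum_o.
have : 2 * (\sum_j i j) = 2 * (#|I|%:R * W).
  transitivity (\sum_j i j - \sum_j o j); first by rewrite sum_o; ring.
  by rewrite -sumrB (eq_bigr _ (fun j _ => iow j)) sumr_const -[LHS]mulr_natl; ring.
by move/mulfI; rewrite pnatr_eq0 => /(_ isT) sum_i; rewrite sum_o sum_i.
Qed.

Lemma vertex_scattering_le z W o i H : normc z <= 1 / 4 ->
  (forall j, i j - o j = 2 * W) -> \sum_j (o j + i j) = 0 ->
  (forall j, normc (i j - z * o j) <= H) -> forall j, normc (o j) <= 5 * H.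
Proof.
move=> z4 iow oi0 hH j; have [sum_i sum_o] := sum_incoming iow oi0.
have zp := normc_1D_ge z4; have zm : 3 / 4 <= normc (1 - z).
  by apply: normc_1D_ge; rewrite normcN.
have I0 : (0 < #|I|)%N by apply/card_gt0P; exists j.
have W_le : 3 / 4 * normc W <= H.
  rewrite -(ler_pM2l (x := #|I|%:R)) ?ltr0n//.
  have : normc ((1 + z) * (#|I|%:R * W)) <= #|I|%:R * H.
    have -> : (1 + z) * (#|I|%:R * W) = \sum_j (i j - z * o j).
      by rewrite sumrB -mulr_sumr sum_i sum_o; ring.
    rewrite (le_trans (ler_normc_sum _ _ _))//.
    apply: (@le_trans _ _ (\sum_(j : I) H)); first exact: ler_sum.
    by rewrite sumr_const mulr_natl.
  rewrite !Normc.normcM normc_nat; apply: le_trans; rewrite mulrCA.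
  by rewrite ler_wpM2r ?mulr_ge0.
have io : (1 - z) * i j = (i j - z * o j) - 2 * z * W.
  transitivity (i j - z * o j - z * (i j - o j)); first by ring.
  by rewrite iow; ring.
have i_le : 3 / 4 * normc (i j) <= H + 1 / 2 * normc W.
  have := ler_normcB (i j - z * o j) (2 * z * W).
  rewrite -io !Normc.normcM normc_nat; have := hH j.
  by have := ler_wpM2r (normc_ge0 (i j)) zm; have := ler_wpM2r (normc_ge0 W) z4; lra.
have -> : o j = i j - 2 * W by rewrite -(iow j); ring.
have := ler_normcB (i j) (2 * W); rewrite Normc.normcM normc_nat.
have := normc_ge0 W; lra.
Qed.

Lemma star_amplitude_le E W o i p m s K : normc E <= 1 / 2 ->
  (forall j, i j - o j = 2 * W) -> \sum_j (o j + i j) = 0 ->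
  (forall j, normc (p j - m j) <= 2 * s) ->
  (forall j, normc (m j - E * o j) <= K) -> (forall j, normc (i j - E * p j) <= K) ->
  forall j, normc (o j) <= 5 * (s + 3 / 2 * K) /\ normc (p j) <= 5 * (s + 3 / 2 * K).
Proof.
move=> damped iow oi0 pm mo ip j.
have round_trip l : normc (i l - E ^+ 2 * o l) <= s + 3 / 2 * K.
  have -> : i l - E ^+ 2 * o l = (i l - E * p l) + E * (p l - m l) + E * (m l - E * o l).
    by ring.
  rewrite (le_trans (le_normcD _ _))// -lerBrDr (le_trans (le_normcD _ _))//.
  rewrite !Normc.normcM; have := pm l; have := mo l; have := ip l.
  by have := normc_ge0 (p l - m l); have := normc_ge0 (m l - E * o l); nra.
have o_le := vertex_scattering_le (normc_sqr_le_quarter damped) iow oi0 round_trip j.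
split => //; have -> : p j = (p j - m j) + (m j - E * o j) + E * o j by ring.
rewrite (le_trans (le_normcD _ _))// -lerBrDr (le_trans (le_normcD _ _))//.
have s0 := le_trans (normc_ge0 _) (pm j); have K0 := le_trans (normc_ge0 _) (mo j).
by rewrite Normc.normcM; have := pm j; have := mo j; have := normc_ge0 (o j); nra.
Qed.

Lemma star_amplitude_exists E (A B a : I -> R[i]) : normc E <= 1 / 2 ->
  exists W o i p m,
  [/\ (forall j, i j - o j = 2 * W), \sum_j (o j + i j) = 0,
      (forall j, p j - m j = a j), (forall j, m j = E * o j - A j) &
      (forall j, i j = E * p j + B j)].
Proof.
move=> damped; have EE := normc_sqr_le_quarter damped.
have EEp : 1 + E ^+ 2 != 0 by rewrite -normc_gt0; have := normc_1D_ge EE; lra.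
have EEm : 1 - E ^+ 2 != 0.
  by rewrite -normc_gt0; have := @normc_1D_ge (- E ^+ 2); rewrite normcN => /(_ EE); lra.
pose h j := E * (a j - A j) + B j.
pose W := (\sum_j h j) / (#|I|%:R * (1 + E ^+ 2)).
pose i j := (h j - 2 * E ^+ 2 * W) / (1 - E ^+ 2).
pose o j := i j - 2 * W; pose m j := E * o j - A j; pose p j := m j + a j.
exists W, o, i, p, m; split => //.
- by move=> j; rewrite /o; ring.
- have [I0|I0] := posnP #|I|; first by rewrite big1// => j; have := fintype0 j I0.
  have NI0 : (#|I|%:R : R[i]) != 0 by rewrite pnatr_eq0 -lt0n.
  have -> : \sum_j (o j + i j) =
      \sum_j (2 / (1 - E ^+ 2) * h j - 2 * (1 + E ^+ 2) / (1 - E ^+ 2) * W).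
    by apply: eq_bigr => j _; rewrite /o /i; field.
  rewrite big_split/= -mulr_sumr sumr_const -mulr_natl /W.
  by field; rewrite NI0 EEp EEm.
- by move=> j; rewrite /p; ring.
- by move=> j; rewrite /p /m /o /i /h; field.
Qed.

End StarScattering.

Section Star.
Context {R : realType} {N : nat}.
Implicit Types (c a : R[i]) (f q y dy : 'I_N -> R -> R[i]) (j k : 'I_N) (K : R).

(* Values and outward fluxes at the inner vertex and at the outer end of an edge:
   edge 1 leaves the vertex at x = 0, the other edges reach it at x = pi. *)
Definition vertex_value y j := if val j == 0%N then y j 0 else y j pi.
Definition end_value y j := if val j == 0%N then y j pi else y j 0.
Definition vertex_flux dy j := if val j == 0%N then - dy j 0 else dy j pi.
Definition end_flux dy j := if val j == 0%N then - dy j pi else dy j 0.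

Definition vertex_out c y dy j := vertex_flux dy j - c * vertex_value y j.
Definition vertex_in c y dy j := vertex_flux dy j + c * vertex_value y j.
Definition end_out c y dy j := end_flux dy j + c * end_value y j.
Definition end_in c y dy j := end_flux dy j - c * end_value y j.

Definition star_solution c a k f y dy :=
  [/\ forall j, edge_solution c (f j) (y j) (dy j),
      exists Y, forall j, vertex_value y j = Y,
      \sum_j vertex_flux dy j = 0 &
      forall j, end_value y j = a * (j == k)%:R].

Lemma star_wavesE c y dy j (r := rwave c (y j) (dy j)) (l := lwave c (y j) (dy j)) :
  [/\ vertex_out c y dy j = if val j == 0%N then - r 0 else l pi,
      vertex_in c y dy j = if val j == 0%N then - l 0 else r pi,
      end_out c y dy j = if val j == 0%N then - l pi else r 0 &
      end_in c y dy j = if val j == 0%N then - r pi else l 0].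
Proof.
rewrite /vertex_out /vertex_in /end_out /end_in /vertex_flux /vertex_value.
by rewrite /end_flux /end_value /r /l /rwave /lwave; case: ifP => _; split; ring.
Qed.

Lemma star_transport_le c f y dy j K : Re c <= 0 ->
  edge_solution c (f j) (y j) (dy j) -> L1norm `[0, pi] (f j) <= K ->
  normc (end_in c y dy j - cexp c pi * vertex_out c y dy j) <= K /\
  normc (vertex_in c y dy j - cexp c pi * end_out c y dy j) <= K.
Proof.
move=> c0 es fK; have l_le := le_trans (lwave_le es c0 (x := 0) _) fK.
have r_le := le_trans (rwave_le es c0 (x := pi) _) fK.
move: l_le r_le; rewrite subr0 !lexx !pi_ge0 => /(_ isT) l_le /(_ isT) r_le.
have [-> -> -> ->] := star_wavesE c y dy j; case: ifP => _ //.
by rewrite !mulrN -!opprD !normcN.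
Qed.

Definition half_damped c := normc (cexp c pi) <= 1 / 2.

Lemma half_damped_Re_lt0 c : half_damped c -> Re c < 0.
Proof.
rewrite /half_damped normc_cexp => damped; have : expR (Re c * pi) < expR 0 by rewrite expR0; lra.
by rewrite ltr_expR pmulr_llt0 ?pi_gt0.
Qed.

Lemma half_damped_neq0 c : half_damped c -> c != 0.
Proof. by move/half_damped_Re_lt0; apply: contraTneq => ->; rewrite ltxx. Qed.

Lemma star_waves_le c a k f y dy K : half_damped c ->
  star_solution c a k f y dy -> (forall j, L1norm `[0, pi] (f j) <= K) -> forall j,
  normc (lwave c (y j) (dy j) pi) <= 5 * (normc c * normc a + 3 / 2 * K) /\
  normc (rwave c (y j) (dy j) 0) <= 5 * (normc c * normc a + 3 / 2 * K).
Proof.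
move=> damped [es [Y hY] sum_flux ends] fK j.
have c0 := ltW (half_damped_Re_lt0 damped).
have vertex_jump i : vertex_in c y dy i - vertex_out c y dy i = 2 * (c * Y).
  by rewrite /vertex_in /vertex_out hY; ring.
have sum0 : \sum_i (vertex_out c y dy i + vertex_in c y dy i) = 0.
  transitivity (\sum_i 2 * vertex_flux dy i); last by rewrite -mulr_sumr sum_flux mulr0.
  by apply: eq_bigr => i _; rewrite /vertex_in /vertex_out; ring.
have source i : normc (end_out c y dy i - end_in c y dy i) <= 2 * (normc c * normc a).
  rewrite (_ : _ - _ = 2 * c * end_value y i); last by rewrite /end_out /end_in; ring.
  rewrite ends !Normc.normcM !normc_nat -mulrA ler_pM2l// ler_wpM2l//.
  by case: (i == k); rewrite ?mulr1 ?mulr0.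
have e_tr i := (star_transport_le c0 (es i) (fK i)).1.
have v_tr i := (star_transport_le c0 (es i) (fK i)).2.
have := star_amplitude_le damped vertex_jump sum0 source e_tr v_tr j.
have [-> _ -> _] := star_wavesE c y dy j.
by case: ifP => _ []; rewrite ?normcN.
Qed.

Lemma star_solution_le c a k f y dy K : half_damped c ->
  star_solution c a k f y dy -> (forall j, L1norm `[0, pi] (f j) <= K) ->
  forall j, normc_bounded `[0, pi] (y j) (5 * normc a + 17 / 2 * K / normc c).
Proof.
move=> damped ss fK j x /=; rewrite in_itv/= => xpi; have [es _ _ _] := ss.
have c0 := ltW (half_damped_Re_lt0 damped).
have c_gt0 : 0 < normc c by rewrite normc_gt0 half_damped_neq0.
have [lpi_le r0_le] := star_waves_le damped ss fK j.
have l_le := le_trans (lwave_le (es j) c0 xpi) (fK j).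
have r_le := le_trans (rwave_le (es j) c0 xpi) (fK j).
have cexp_rev_le1 : normc (cexp c (pi - x)) <= 1 by apply: normc_cexp_le1; nra.
have cexp_le1 : normc (cexp c x) <= 1 by apply: normc_cexp_le1; nra.
set r := rwave c (y j) (dy j) in r0_le r_le; set l := lwave c (y j) (dy j) in lpi_le l_le.
have lx_le : normc (l x) <= K + normc (l pi).
  rewrite -(subrK (cexp c (pi - x) * l pi) (l x)) (le_trans (le_normcD _ _))// lerD//.
  by rewrite Normc.normcM ler_piMl.
have rx_le : normc (r x) <= K + normc (r 0).
  rewrite -(subrK (cexp c x * r 0) (r x)) (le_trans (le_normcD _ _))// lerD//.
  by rewrite Normc.normcM ler_piMl.
have : 2 * normc c * normc (y j x) <= normc (r x) + normc (l x).
  rewrite -(normc_nat 2) -!Normc.normcM (_ : 2 * c * y j x = r x - l x) ?ler_normcB//.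
  by rewrite /r /l /rwave /lwave; ring.
have -> : 5 * normc a + 17 / 2 * K / normc c =
    (10 * (normc c * normc a) + 17 * K) / (2 * normc c).
  by field; rewrite gt_eqF.
rewrite ler_pdivlMr ?mulr_gt0//; lra.
Qed.

Lemma star_edge_exists c (f : R -> R[i]) j : c != 0 -> cintegrable `[0, pi] f ->
  exists A B : R[i], forall o p, exists y dy : R -> R[i], edge_solution c f y dy /\
    [/\ vertex_out c (fun=> y) (fun=> dy) j = o, end_out c (fun=> y) (fun=> dy) j = p,
        end_in c (fun=> y) (fun=> dy) j = cexp c pi * o - A &
        vertex_in c (fun=> y) (fun=> dy) j = cexp c pi * p + B].
Proof.
move=> c0 fi; have [A [B sol]] := edge_solution_exists c0 fi.
have [j0|j0] := boolP (val j == 0%N).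
- exists B, A => o p; have [y [dy [es lpi r0 l0 rpi]]] := sol (- p) (- o).
  exists y, dy; split => //; have [-> -> -> ->] := star_wavesE c (fun=> y) (fun=> dy) j.
  by rewrite j0 lpi r0 l0 rpi; split; ring.
- exists A, B => o p; have [y [dy [es lpi r0 l0 rpi]]] := sol o p.
  exists y, dy; split => //; have [-> -> -> ->] := star_wavesE c (fun=> y) (fun=> dy) j.
  by rewrite (negbTE j0).
Qed.

Lemma star_solution_exists c a k f : half_damped c ->
  (forall j, cintegrable `[0, pi] (f j)) -> exists y dy, star_solution c a k f y dy.
Proof.
move=> damped fi; have c0 := half_damped_neq0 damped.
have [A hA] := choice (fun j => star_edge_exists j c0 (fi j)).
have [B hB] := choice hA.
have [W [out [inc [p [m [vertex_jump sum0 source e_tr v_tr]]]]]] :=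
  star_amplitude_exists A B (fun j => 2 * c * (a * (j == k)%:R)) damped.
have [y hy] := choice (fun j => hB j (out j) (p j)); have [dy ydy] := choice hy.
have vertex_outE j : vertex_out c y dy j = out j by have [_ []] := ydy j.
have end_outE j : end_out c y dy j = p j by have [_ []] := ydy j.
have end_inE j : end_in c y dy j = m j by rewrite e_tr; have [_ []] := ydy j.
have vertex_inE j : vertex_in c y dy j = inc j by rewrite v_tr; have [_ []] := ydy j.
have two_c0 : 2 * c != 0 by rewrite mulf_neq0 ?pnatr_eq0.
exists y, dy; split.
- by move=> j; have [] := ydy j.
- exists (c^-1 * W) => j; apply: (mulfI two_c0).
  transitivity (inc j - out j).
    by rewrite -vertex_inE -vertex_outE /vertex_in /vertex_out; ring.
  by rewrite vertex_jump; field.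
- apply: (@mulfI _ 2); first by rewrite pnatr_eq0.
  transitivity (\sum_j (out j + inc j)); last by rewrite sum0 mulr0.
  rewrite mulr_sumr; apply: eq_bigr => j _.
  by rewrite -vertex_inE -vertex_outE /vertex_in /vertex_out; ring.
- move=> j; apply: (mulfI two_c0); rewrite -source -end_outE -end_inE.
  by rewrite /end_out /end_in; ring.
Qed.

Lemma star_solutionB c a1 a2 k f1 f2 y1 y2 dy1 dy2 :
  star_solution c a1 k f1 y1 dy1 -> star_solution c a2 k f2 y2 dy2 ->
  star_solution c (a1 - a2) k (fun j x => f1 j x - f2 j x)
    (fun j x => y1 j x - y2 j x) (fun j x => dy1 j x - dy2 j x).
Proof.
move=> [es1 [Y1 hY1] flux1 ends1] [es2 [Y2 hY2] flux2 ends2]; split.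
- move=> j; have [y1_dy1 dy1_f1] := es1 j; have [y2_dy2 dy2_f2] := es2 j.
  split; first exact: AC_B.
  by apply: eq_AC (AC_B dy1_f1 dy2_f2) => // x _; ring.
- exists (Y1 - Y2) => j; rewrite -(hY1 j) -(hY2 j) /vertex_value.
  by case: ifP.
- rewrite -[RHS]subr0 -[X in _ = X - _]flux1 -[X in _ = _ - X]flux2 -sumrB.
  by apply: eq_bigr => j _; rewrite /vertex_flux; case: ifP => _; ring.
- move=> j; rewrite mulrBl -ends1 -ends2 /end_value; by case: ifP.
Qed.

Lemma eq_star_solution c a k f1 f2 y dy :
  (forall j x, 0 <= x <= pi -> f1 j x = f2 j x) ->
  star_solution c a k f1 y dy -> star_solution c a k f2 y dy.
Proof.
move=> ff [es vertex flux ends]; split => // j; have [acy acdy] := es j; split => //.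
by apply: eq_AC acdy => // x xpi; rewrite ff.
Qed.

Lemma matchingP y dy : (0 < N)%N -> matching y dy <->
  (exists Y, forall j, vertex_value y j = Y) /\ \sum_j vertex_flux dy j = 0.
Proof.
move=> N0; pose r : 'I_N := Ordinal N0.
have rE j : (val j == 0%N) = (j == r) by rewrite -val_eqE.
have sum_flux : \sum_j vertex_flux dy j = \sum_(j < N | val j != 0%N) dy j pi - dy r 0.
  rewrite (bigD1 r)//= addrC /vertex_flux eqxx; congr (_ - _).
  by apply: eq_big => [j|j /negbTE]; rewrite -rE// => ->.
split=> [/(_ r erefl) [y_eq flux]|[[Y hY] flux] r' r'0].
- split; last by rewrite sum_flux -flux subrr.
  exists (y r 0) => j; rewrite /vertex_value; case: ifPn => [|/y_eq <-//].
  by rewrite rE => /eqP ->.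
- have -> : r' = r by apply/eqP; rewrite -rE r'0.
  have := hY r; rewrite /vertex_value eqxx => yr; split=> [j j0|].
    by have := hY j; rewrite /vertex_value (negbTE j0) yr.
  by apply/eqP; rewrite eq_sym -subr_eq0 -sum_flux flux.
Qed.

Lemma end_valueP k y : val k != 0%N ->
  (forall j, end_value y j = (j == k)%:R) <->
  (forall r : 'I_N, val r = 0%N -> y r pi = 0) /\
  (forall j : 'I_N, val j != 0%N -> y j 0 = (j == k)%:R).
Proof.
move=> k0; have root_neq r : val r = 0%N -> (r == k) = false.
  by move=> r0; apply: contraNF k0 => /eqP <-; rewrite r0.
split=> [ends|[end_r end_j] j].
  split=> [r r0|j j0]; last by rewrite -ends /end_value (negbTE j0).
  by have := ends r; rewrite /end_value r0/= => ->; rewrite root_neq.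
rewrite /end_value; case: ifPn => [/eqP j0|/end_j//].
by rewrite end_r// root_neq.
Qed.

Definition potential_mul q y : 'I_N -> R -> R[i] := fun j x => q j x * y j x.

Lemma weyl_solutionP c k q y dy :
  val k != 0%N -> (forall j, cmeasurable_fun `[0, pi] (q j)) ->
  weyl_solution q k (- c ^+ 2) y dy <-> star_solution c 1 k (potential_mul q y) y dy.
Proof.
move=> k0 mq; have N0 : (0 < N)%N by exact: leq_ltn_trans (ltn_ord k).
have edgeP j := SL_edge_solutionP c (y j) (dy j) (mq j).
split=> [[[sl /(matchingP _ _ N0) [vertex flux]] end_r end_j]|[es vertex flux ends]].
- split=> // j; first exact: (edgeP j).1 (sl j).
  by rewrite mul1r; exact: (end_valueP y k0).2 (conj end_r end_j) j.
- have [end_r end_j] : (forall r : 'I_N, val r = 0%N -> y r pi = 0) /\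
      (forall j : 'I_N, val j != 0%N -> y j 0 = (j == k)%:R).
    by apply/(end_valueP y k0) => j; rewrite ends mul1r.
  by split=> //; split=> [j|]; [exact: (edgeP j).2 (es j)|exact/matchingP].
Qed.

End Star.

Section StarPotential.
Context {R : realType} {N : nat}.
Implicit Types (a : R[i]) (y dy z : 'I_N -> R -> R[i]) (j : 'I_N) (B : R).

Variables (c : R[i]) (k : 'I_N) (q : 'I_N -> R -> R[i]) (Q : R).
Hypotheses (damped : half_damped c)
  (qi : forall j, cintegrable `[0, pi] (q j))
  (qQ : forall j, L1norm `[0, pi] (q j) <= Q) (Qc : 17 * Q <= normc c).

Lemma star_step_le a y dy z B : (forall j, cmeasurable_fun `[0, pi] (z j)) ->
  (forall j, normc_bounded `[0, pi] (z j) B) ->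
  star_solution c a k (potential_mul q z) y dy ->
  forall j, normc_bounded `[0, pi] (y j) (5 * normc a + B / 2).
Proof.
move=> mz zB ss j x x0pi; have c_gt0 : 0 < normc c by rewrite normc_gt0 half_damped_neq0.
have B0 : 0 <= B := le_trans (normc_ge0 _) (zB j x x0pi).
have qz_le i : L1norm `[0, pi] (potential_mul q z i) <= Q * B.
  apply: le_trans (L1normMr_le (measurable_itv _) (qi i) (mz i) (zB i)) _.
  by rewrite ler_wpM2r.
apply: (le_trans (star_solution_le damped ss qz_le j x0pi)); rewrite lerD2l.
by rewrite ler_pdivrMr//; have := ler_wpM2r B0 Qc; lra.
Qed.

Lemma star_potential_le a y dy : star_solution c a k (potential_mul q y) y dy ->
  forall j, normc_bounded `[0, pi] (y j) (10 * normc a).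
Proof.
move=> ss; have [es _ _ _] := ss.
pose values := [set t | exists j x, `[0, pi]%classic x /\ t = normc (y j x)].
pose b j := normc (y j 0) + L1norm `[0, pi] (dy j).
have has_sup_values : has_sup values.
  split; first by exists (normc (y k 0)), k, 0; rewrite /= in_itv/= lexx pi_ge0.
  exists (\sum_j b j) => _ [j [x [x0pi ->]]]; apply: (le_trans (AC_bounded (es j).1 x0pi)).
  rewrite (bigD1 j)//= lerDl; apply: sumr_ge0 => i _.
  by rewrite addr_ge0// L1norm_ge0.
have y_sup j : normc_bounded `[0, pi] (y j) (sup values).
  by move=> x x0pi; apply: sup_upper_bound => //; exists j, x.
suff : sup values <= 5 * normc a + sup values / 2.
  by move=> sup_le j x /(y_sup j); lra.
apply: sup_le_ub; first exact: has_sup_values.1.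
move=> _ [j [x [x0pi ->]]]; apply: star_step_le y_sup ss _ _ x0pi => i.
exact: AC_measurable (es i).1.
Qed.

Lemma star_free_close a y y0 dy dy0 :
  star_solution c a k (potential_mul q y) y dy ->
  star_solution c a k (fun _ _ => 0) y0 dy0 ->
  forall j, normc_bounded `[0, pi] (fun x => y j x - y0 j x) (85 * normc a * Q / normc c).
Proof.
move=> ss ss0 j; have [es _ _ _] := ss; have := star_solutionB ss ss0; rewrite subrr.
move=> /(eq_star_solution (f2 := potential_mul q y)) ssB.
have qy_le i : L1norm `[0, pi] (potential_mul q y i) <= Q * (10 * normc a).
  have yi := AC_measurable (es i).1; have y_le := star_potential_le ss i.
  apply: le_trans (L1normMr_le (measurable_itv _) (qi i) yi y_le) _.
  by rewrite ler_wpM2r// mulr_ge0.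
have := star_solution_le damped (ssB _) qy_le j; rewrite Normc.normc0 mulr0 add0r.
have -> : 17 / 2 * (Q * (10 * normc a)) / normc c = 85 * normc a * Q / normc c.
  by field; rewrite gt_eqF// normc_gt0 half_damped_neq0.
by apply => i x _; rewrite subr0.
Qed.

Lemma star_step_contraction a y1 y2 dy1 dy2 z1 z2 B :
  (forall j, cmeasurable_fun `[0, pi] (z1 j)) -> (forall j, cmeasurable_fun `[0, pi] (z2 j)) ->
  star_solution c a k (potential_mul q z1) y1 dy1 ->
  star_solution c a k (potential_mul q z2) y2 dy2 ->
  (forall j, normc_bounded `[0, pi] (fun x => z1 j x - z2 j x) B) ->
  forall j, normc_bounded `[0, pi] (fun x => y1 j x - y2 j x) (B / 2).
Proof.
move=> mz1 mz2 ss1 ss2 zB j; have := star_solutionB ss1 ss2; rewrite subrr.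
move=> /(eq_star_solution (f2 := potential_mul q (fun j x => z1 j x - z2 j x))) ss.
rewrite (_ : B / 2 = 5 * normc (0 : R[i]) + B / 2); last by rewrite Normc.normc0; ring.
apply: star_step_le zB (ss _) j; first by move=> i; exact: cmeasurableB.
by move=> i x _; rewrite /potential_mul mulrBr.
Qed.

Lemma picard_iterates a : exists Y dY : nat -> 'I_N -> R -> R[i],
  (forall j x, Y 0%N j x = 0) /\
  forall n, star_solution c a k (potential_mul q (Y n)) (Y n.+1) (dY n.+1).
Proof.
have step z : exists w : ('I_N -> R -> R[i]) * ('I_N -> R -> R[i]),
    (forall j, cintegrable `[0, pi] (potential_mul q z j)) ->
    star_solution c a k (potential_mul q z) w.1 w.2.
  have [qz|] := pselect (forall j, cintegrable `[0, pi] (potential_mul q z j)).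
    by have [y [dy ss]] := star_solution_exists a k damped qz; exists (y, dy).
  by exists (z, z).
have [g hg] := choice step; pose next (w : ('I_N -> R -> R[i]) * ('I_N -> R -> R[i])) := g w.1.
pose Y n := iter n next (fun _ _ => 0, fun _ _ => 0).
pose qY n j x := q j x * (Y n).1 j x.
have next_solution n : (forall j, cintegrable `[0, pi] (qY n j)) ->
    star_solution c a k (qY n) (Y n.+1).1 (Y n.+1).2 by exact: hg.
have qY_integrable n j : cintegrable `[0, pi] (qY n j).
  elim: n j => [|n /next_solution[es _ _ _]] j.
    exact: AC_cintegrableMr (AC_cst 0) (qi j).
  exact: AC_cintegrableMr (es j).1 (qi j).
exists (fun n => (Y n).1), (fun n => (Y n).2); split => // n.
exact: next_solution.
Qed.

Lemma picard_step_le a Y dY : (forall j x, Y 0%N j x = 0) ->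
  (forall n, star_solution c a k (potential_mul q (Y n)) (Y n.+1) (dY n.+1)) ->
  forall n j, normc_bounded `[0, pi] (fun x => Y n.+1 j x - Y n j x)
    (5 * normc a / 2 ^+ n).
Proof.
move=> Y0 ss; have mY n j : cmeasurable_fun `[0, pi] (Y n j).
  case: n => [|n]; last by have [es _ _ _] := ss n; exact: AC_measurable (es j).1.
  by rewrite (_ : Y 0%N j = fun=> 0); [exact: cmeasurable_cst|exact/funext].
elim=> [|n ih] j.
  rewrite expr0 divr1 => x x0pi; rewrite Y0 subr0.
  have := star_step_le (B := 0) (mY 0%N) _ (ss 0%N) j x0pi.
  by rewrite mul0r addr0; apply => i t _; rewrite Y0 Normc.normc0.
have -> : 5 * normc a / 2 ^+ n.+1 = (5 * normc a / 2 ^+ n) / 2.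
  by rewrite exprS; field; rewrite expf_neq0.
exact: star_step_contraction (ss n.+1) (ss n) ih j.
Qed.

(* The limit L of the Picard iterates is bounded and measurable; the solution driven by
   q L is as close to the iterates as L and hence equal to L. *)
Lemma star_potential_exists a : exists y dy,
  star_solution c a k (potential_mul q y) y dy.
Proof.
have [Y [dY [Y0 ss]]] := picard_iterates a; pose C := 5 * normc a.
have step := picard_step_le Y0 ss.
have mY n j : cmeasurable_fun `[0, pi] (Y n.+1 j).
  by have [es _ _ _] := ss n; exact: AC_measurable (es j).1.
have [L' hL'] := choice (fun j => function_halving_limit (step^~ j)).
pose L j : R -> R[i] := L' j.
have hL n j : normc_bounded `[0, pi] (fun x => L j x - Y n j x) (4 * C / 2 ^+ n).
  exact: hL'.
have mL j : cmeasurable_fun `[0, pi] (L j).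
  apply: (cmeasurable_halving_limit (C := 2 * C) (mY^~ j)) => n x x0pi.
  rewrite (_ : 2 * C / 2 ^+ n = 4 * C / 2 ^+ n.+1); first exact: hL.
  by rewrite exprS; field; rewrite expf_neq0.
have bL j : normc_bounded `[0, pi] (L j) (4 * C).
  by move=> x x0pi; have := hL 0%N j x x0pi; rewrite expr0 divr1 Y0 subr0.
have [y [dy ssL]] := star_solution_exists a k damped (fun j =>
  cintegrableMr (measurable_itv _) (mL j) (bL j) (qi j)).
exists y, dy; apply: (eq_star_solution _ ssL) => j x xpi; congr (_ * _).
apply/eqP; rewrite -subr_eq0 -normc_le0; apply: (@le0_halving _ _ (2 * C)) => n.
have yY := star_step_contraction mL (mY n) ssL (ss n.+1) (hL n.+1) j xpi.
have -> : L j x - y j x = (L j x - Y n.+2 j x) - (y j x - Y n.+2 j x) by ring.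
apply: (le_trans (ler_normcB _ _)); have := hL n.+2 j x xpi.
rewrite (_ : 2 * C / 2 ^+ n = 4 * C / 2 ^+ n.+2 + 4 * C / 2 ^+ n.+1 / 2); first lra.
by rewrite !exprS; field; rewrite expf_neq0.
Qed.

End StarPotential.

Section SquareIntegrable.
Context {R : realType}.
Notation mu := (@lebesgue_measure R).
Implicit Types (D : set (measurableTypeR R)) (g h : R -> R[i]) (a b : R).

Definition square_integrable D g := cmeasurable_fun D g /\
  mu.-integrable D (EFin \o (fun x => normc (g x) ^+ 2)).

Lemma square_integrable_le D g h : measurable D -> cmeasurable_fun D h ->
  (forall x, D x -> normc (h x) <= normc (g x)) -> square_integrable D g ->
  square_integrable D h /\ sqr_L2norm D h <= sqr_L2norm D g.
Proof.
move=> mD mh hg [mg gi].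
have sqr_le x : D x -> normc (h x) ^+ 2 <= normc (g x) ^+ 2.
  by move=> /hg; rewrite ler_pXn2r ?nnegrE.
have hi : mu.-integrable D (EFin \o (fun x => normc (h x) ^+ 2)).
  apply: le_integrable gi => //; first by apply/measurable_EFinP; exact: measurable_sqr_normc.
  by move=> x /sqr_le hgx; rewrite lee_fin !ger0_norm ?sqr_ge0.
by split => //; exact: le_Rintegral.
Qed.

Lemma square_integrableN D g : measurable D -> square_integrable D g ->
  square_integrable D (fun x => - g x).
Proof.
move=> mD g2; apply: (square_integrable_le mD _ _ g2).1; first exact: cmeasurableN g2.1.
by move=> x _; rewrite normcN.
Qed.

Lemma square_integrableD D g h : measurable D -> square_integrable D g ->
  square_integrable D h -> square_integrable D (fun x => g x + h x).
Proof.
move=> mD [mg gi] [mh hi]; have mgh := cmeasurableD mg mh; split => //.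
apply: (@le_integrable _ _ _ mu _ _ _
  (EFin \o (fun x => 2 * normc (g x) ^+ 2 + 2 * normc (h x) ^+ 2))) => //.
- by apply/measurable_EFinP; exact: measurable_sqr_normc.
- move=> x _ /=; rewrite lee_fin [leLHS]ger0_norm ?sqr_ge0// (le_trans _ (ler_norm _))//.
  have := le_normcD (g x) (h x); have := normc_ge0 (g x + h x).
  by have := sqr_ge0 (normc (g x) - normc (h x)); nra.
- by apply: integrable_EFinD => //; exact: integrable_EFinZ.
Qed.

Lemma square_integrableB D g h : measurable D -> square_integrable D g ->
  square_integrable D h -> square_integrable D (fun x => g x - h x).
Proof. by move=> mD g2 /(square_integrableN mD); exact: square_integrableD. Qed.

Lemma square_integrable_bounded a b g (B : R) : cmeasurable_fun `[a, b] g ->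
  normc_bounded `[a, b] g B -> square_integrable `[a, b] g.
Proof.
move=> mg gB; split => //.
apply: le_integrable (integrable_itv_cst a b (B ^+ 2)) => //.
  by apply/measurable_EFinP; exact: measurable_sqr_normc.
move=> x abx; rewrite lee_fin !ger0_norm ?sqr_ge0// ler_pXn2r ?nnegrE//; first exact: gB.
exact: le_trans (gB x abx).
Qed.

Lemma square_integrable_cintegrable a b g :
  square_integrable `[a, b] g -> cintegrable `[a, b] g.
Proof.
move=> [mg gi]; apply: (@cintegrable_le _ _ _ _ (fun x => 1 + normc (g x) ^+ 2)) => //.
  by apply: integrable_EFinD => //; exact: integrable_itv_cst.
by move=> x _; have := normc_ge0 (g x); nra.
Qed.

(* Integrating (|g| - m)^2 >= 0 with m the mean of |g|. *)
Lemma sqr_L1norm_le a b g : a < b -> square_integrable `[a, b] g ->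
  L1norm `[a, b] g ^+ 2 <= (b - a) * sqr_L2norm `[a, b] g.
Proof.
move=> ab g2; have gi := square_integrable_cintegrable g2.
have ni := cintegrable_normc (measurable_itv _) gi.
pose m := L1norm `[a, b] g / (b - a).
have L1E : L1norm `[a, b] g = m * (b - a) by rewrite /m divfK// gt_eqF// subr_gt0.
have : 2 * m * L1norm `[a, b] g <= sqr_L2norm `[a, b] g + m ^+ 2 * (b - a).
  have mi := integrable_itv_cst a b (m ^+ 2).
  rewrite -RintegralZl// -Rintegral_itv_cst ?(ltW ab)// -RintegralD//; last exact: g2.2.
  apply: le_Rintegral => //; first exact: integrable_EFinZ.
    by apply: integrable_EFinD => //; exact: g2.2.
  by move=> x _; have := sqr_ge0 (normc (g x) - m); nra.
rewrite L1E; have : 0 < b - a by rewrite subr_gt0.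
by nra.
Qed.

Lemma inL2_square_integrable a b g : inL2 `]a, b[ g ->
  square_integrable `[a, b] g /\
  L2norm `]a, b[ g = (Num.sqrt (sqr_L2norm `[a, b] g))%:E.
Proof.
move=> [/cmeasurable_itv_oo_cc mg gfin].
have m2 : measurable_fun (`[a, b]%classic : set (measurableTypeR R))
    (fun x => (normc (g x) ^+ 2)%:E).
  by apply/measurable_EFinP; exact: measurable_sqr_normc.
have int_oo_cc : (\int[mu]_(x in `]a, b[) (normc (g x) ^+ 2)%:E =
                  \int[mu]_(x in `[a, b]) (normc (g x) ^+ 2)%:E)%E.
  rewrite integral_itv_obnd_cbnd ?integral_itv_bndo_bndc//;
  by apply: measurable_funS m2 => //; apply: subset_itv; rewrite bnd_simp.
have int_ge0 : (0 <= \int[mu]_(x in `[a, b]) (normc (g x) ^+ 2)%:E)%E.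
  by apply: integral_ge0 => x _; rewrite lee_fin sqr_ge0.
have int_fin : (\int[mu]_(x in `[a, b]) (normc (g x) ^+ 2)%:E < +oo)%E.
  rewrite ltey; apply/eqP => int_y; move: gfin.
  by rewrite /L2norm int_oo_cc int_y poweRyr ?ltxx.
split; last first.
  by rewrite /L2norm int_oo_cc poweR12_sqrt// -[X in sqrte X]fineK ?ge0_fin_numE.
split => //; apply/integrableP; split => //.
by under eq_integral do rewrite gee0_abs ?lee_fin ?sqr_ge0//; exact: int_fin.
Qed.

Lemma square_integrable_inL2 a b g : square_integrable `[a, b] g -> inL2 `]a, b[ g.
Proof.
move=> g2; have sub : `]a, b[ `<=` `[a, b] by apply: subset_itv; rewrite bnd_simp.
split; first exact: cmeasurableS sub g2.1.
by apply: poweR_lty; apply: integrable_lty => //; apply: integrableS g2.2.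
Qed.

End SquareIntegrable.

Section Bessel.
Context {R : realType}.
Notation mu := (@lebesgue_measure R).
Implicit Types (g : R -> R[i]) (s t x : R).

Definition osc s x : R[i] := cexp (Complex 0 (2 * s)) x.

Definition fourier g s := cintegral `[0, pi] (fun x => g x * osc s x).

Definition fourier_mode g s x : R[i] := Complex pi^-1 0 * fourier g s * osc (- s) x.

Lemma normc_osc s x : normc (osc s x) = 1.
Proof. by rewrite normc_cexp mul0r expR0. Qed.

Lemma oscD s t x : osc (s + t) x = osc s x * osc t x.
Proof.
rewrite /osc -cexpDl; congr (cexp _ x).
by apply: complex_ext; rewrite /= ?addr0 ?mulrDr.
Qed.

Lemma oscN s x : osc (- s) x = osc s (- x).
Proof. by rewrite /osc -cexpNl; congr (cexp _ x); apply: complex_ext => /=; ring. Qed.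

Lemma conjc_osc s x : conjc (osc s x) = osc (- s) x.
Proof.
rewrite /osc /cexp/= (_ : 2 * - s * x = - (2 * s * x)); last by ring.
by rewrite cosN sinN mulrN.
Qed.

Lemma osc_natr_pi n : osc n%:R pi = 1.
Proof.
have osc1 : osc 1 pi = 1.
  by rewrite /osc /cexp/= mul0r expR0 !mul1r mulr1 mulr_natl cos2pi sin2pi.
elim: n => [|n ih]; last by rewrite -natr1 oscD ih osc1 mulr1.
by rewrite /osc mulr0; exact: cexp0l.
Qed.

Lemma AC_osc s : AC (osc s) (fun x => Complex 0 (2 * s) * osc s x).
Proof. exact: AC_cexp. Qed.

Lemma osc_orthogonal (m n : nat) : m != n -> cintegral `[0, pi] (osc (m%:R - n%:R)) = 0.
Proof.
move=> mn; set s : R := m%:R - n%:R.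
have := AC_increment (AC_osc s) (lexx _) (pi_ge0 R) (lexx _).
have -> : osc s pi = 1.
  by rewrite -[LHS]mulr1 -{1}(osc_natr_pi n) -oscD /s subrK osc_natr_pi.
rewrite {1}/osc cexp0 subrr cintegralZ//; last exact: AC_cintegrable (AC_osc s).
move=> /esym/eqP; rewrite mulf_eq0 => /orP[|/eqP//].
by rewrite eq_complex/= eqxx/= mulf_eq0 pnatr_eq0/= subr_eq0 eqr_nat (negbTE mn).
Qed.

Lemma cintegrable_osc g s : cintegrable `[0, pi] g ->
  cintegrable `[0, pi] (fun x => g x * osc s x).
Proof. exact: AC_cintegrableMr (AC_osc s). Qed.

Lemma normc_fourier_mode g s x : normc (fourier_mode g s x) = normc (fourier g s) / pi.
Proof.
by rewrite !Normc.normcM normc_osc mulr1 normc_real ger0_norm ?invr_ge0 ?pi_ge0// mulrC.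
Qed.

Lemma fourier_mode_square_integrable g s : square_integrable `[0, pi] (fourier_mode g s).
Proof.
apply: (square_integrable_bounded (B := normc (fourier g s) / pi)).
  by apply: cmeasurableM; [exact: cmeasurable_cst|exact: AC_measurable (AC_osc _)].
by move=> x _; rewrite normc_fourier_mode.
Qed.

Lemma fourierB_mode g t (m n : nat) : square_integrable `[0, pi] g -> n != m ->
  fourier (fun x => g x - fourier_mode g (t + m%:R) x) (t + n%:R) = fourier g (t + n%:R).
Proof.
move=> /square_integrable_cintegrable gi nm.
have mode_i := square_integrable_cintegrable (fourier_mode_square_integrable g (t + m%:R)).
rewrite -[RHS]subr0 /fourier; under eq_cintegral do rewrite mulrBl.
rewrite cintegralB//; [congr (_ - _)|exact: cintegrable_osc..].
rewrite -[RHS](mulr0 (Complex pi^-1 0 * fourier g (t + m%:R))) -(osc_orthogonal nm).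
rewrite -cintegralZ//; last exact: AC_cintegrable (AC_osc _).
apply: eq_cintegral => x _; rewrite /fourier_mode -[LHS]mulrA -oscD.
by congr (_ * osc _ _); ring.
Qed.

Lemma sqr_L2normB_mode g s : square_integrable `[0, pi] g ->
  pi * sqr_L2norm `[0, pi] (fun x => g x - fourier_mode g s x) =
  pi * sqr_L2norm `[0, pi] g - normc (fourier g s) ^+ 2.
Proof.
move=> g2; have gi := square_integrable_cintegrable g2.
set F := fourier g s; pose kappa : R[i] := Complex pi^-1 0 * F.
have oi : cintegrable `[0, pi] (fun x => conjc kappa * (g x * osc s x)).
  by apply: cintegrableZ => //; exact: cintegrable_osc.
have expand x : normc (g x - fourier_mode g s x) ^+ 2 =
    (normc (g x) ^+ 2 + (normc F / pi) ^+ 2) + - 2 * Re (conjc kappa * (g x * osc s x)).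
  rewrite sqr_normcB normc_fourier_mode mulNr; congr (_ - 2 * Re _).
  by rewrite /fourier_mode -/F -/kappa conjcM conjc_osc opprK; ring.
have ci := integrable_itv_cst 0 pi ((normc F / pi) ^+ 2).
rewrite /sqr_L2norm; under eq_Rintegral do rewrite expand.
rewrite RintegralD//; last by apply: integrable_EFinZ => //; exact: oi.1.
  rewrite RintegralD//; last exact: g2.2.
  rewrite Rintegral_itv_cst ?pi_ge0// subr0 RintegralZl//; last exact: oi.1.
  have -> : Rintegral mu `[0, pi] (fun x => Re (conjc kappa * (g x * osc s x))) =
      Re (conjc kappa * F) by rewrite -cintegralZ//; exact: cintegrable_osc.
  have -> : Re (conjc kappa * F) = normc F ^+ 2 / pi.
    by rewrite sqr_normcE /kappa; case: (F) => u v /=; ring.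
  have complete_square (p u v : R) : p != 0 ->
      p * (u + (v / p) ^+ 2 * p + - 2 * (v ^+ 2 / p)) = p * u - v ^+ 2.
    by move=> p0; field.
  by rewrite complete_square// gt_eqF// pi_gt0.
by apply: integrable_EFinD => //; exact: g2.2.
Qed.

(* Subtracting from g its component along one exponential lowers the integral of |g|^2
   by |coefficient|^2 / pi and leaves the other coefficients unchanged. *)
Lemma bessel (S : seq nat) t g : uniq S -> square_integrable `[0, pi] g ->
  \sum_(n <- S) normc (fourier g (t + n%:R)) ^+ 2 <= pi * sqr_L2norm `[0, pi] g.
Proof.
elim: S g => [|m S ih] g /=.
  by move=> _ _; rewrite big_nil mulr_ge0 ?pi_ge0// sqr_L2norm_ge0.
move=> /andP[mS uS] g2; rewrite big_cons -lerBrDl -sqr_L2normB_mode//.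
have w2 := fourier_mode_square_integrable g (t + m%:R).
apply: le_trans (ih _ uS (square_integrableB (measurable_itv _) g2 w2)).
rewrite [leRHS](eq_big_seq (fun n => normc (fourier g (t + n%:R)) ^+ 2))// => n nS.
by rewrite fourierB_mode//; apply: contraNneq mS => <-.
Qed.

End Bessel.

Section Plancherel.
Context {R : realType}.
Notation mu := (@lebesgue_measure R).
Implicit Types (g : R -> R[i]) (h : R -> R) (s t u x : R).

Lemma lipschitz_continuous h (K : R) :
  (forall s t, `|h s - h t| <= K * `|s - t|) -> continuous h.
Proof.
move=> hK s; apply/cvgrPdist_le => e e0; have K0 : 0 < `|K| + 1 by rewrite ltr_wpDl.
near=> t; apply: (le_trans (hK s t)).
have st : (`|K| + 1) * `|s - t| <= e.
  rewrite mulrC -ler_pdivlMr// ltW//; near: t; apply: cvgr_dist_lt => //.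
  by rewrite divr_gt0.
by apply: le_trans st; rewrite ler_wpM2r//; have := ler_norm K; lra.
Unshelve. all: by end_near. Qed.

Lemma osc_sub1_le s x : 0 <= x <= pi -> normc (osc s x - 1) <= 2 * pi * `|s|.
Proof.
move=> /andP[x0 xpi]; rewrite -(cexp0 (Complex 0 (2 * s))).
apply: le_trans (AC_increment_le (AC_osc s) (lexx _) (lexx _) (lexx _) x0 xpi) _.
rewrite /L1norm; under eq_Rintegral do rewrite Normc.normcM normc_osc mulr1.
rewrite Rintegral_itv_cst ?pi_ge0// subr0 /= expr0n/= add0r sqrtr_sqr normrM ger0_norm//.
by rewrite mulrAC.
Qed.

Lemma fourier_lipschitz g s t : cintegrable `[0, pi] g ->
  normc (fourier g s - fourier g t) <= L1norm `[0, pi] g * (2 * pi * `|s - t|).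
Proof.
move=> gi; rewrite /fourier -cintegralB//; [|exact: cintegrable_osc..].
have osc_le x : 0 <= x <= pi -> normc (osc s x - osc t x) <= 2 * pi * `|s - t|.
  move=> x0pi; have -> : osc s x - osc t x = (osc (s - t) x - 1) * osc t x.
    by rewrite mulrBl mul1r -oscD subrK.
  by rewrite Normc.normcM normc_osc mulr1 osc_sub1_le.
have mosc := cmeasurableB (AC_measurable (AC_osc s)) (AC_measurable (AC_osc t)).
apply: le_trans (L1normMr_le (measurable_itv _) gi mosc osc_le).
rewrite [X in normc X](_ : _ = cintegral `[0, pi] (fun x => g x * (osc s x - osc t x))).
  by apply: le_normc_cintegral => //; exact: (cintegrableMr (measurable_itv _) mosc osc_le gi).
by apply: eq_cintegral => x _; rewrite mulrBr.
Qed.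

Lemma continuous_sqr_fourier g : cintegrable `[0, pi] g ->
  continuous (fun s => normc (fourier g s) ^+ 2).
Proof.
move=> gi; have cF : continuous (fun s => normc (fourier g s)).
  apply: (lipschitz_continuous (K := L1norm `[0, pi] g * (2 * pi))) => s t.
  apply: (le_trans (ler_dist_normc _ _)); rewrite -mulrA; exact: fourier_lipschitz.
by move=> s; apply: cvgM; exact: cF.
Qed.

Lemma continuous_comp_shift h u : continuous h -> continuous (fun x => h (x + u)).
Proof.
move=> ch x; apply: continuous_comp; last exact: ch.
by apply: cvgD; [exact: cvg_id|exact: cvg_cst].
Qed.

Lemma continuous_shift_sum h u n : continuous h ->
  continuous (fun x => \sum_(0 <= i < n) h (x + (u + i%:R))).
Proof.
move=> ch; elim: n => [|n ih] x.
  by under eq_fun do rewrite big_nil; exact: cst_continuous.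
under eq_fun do rewrite big_nat_recr//=.
by apply: cvgD; [exact: ih|exact: continuous_comp_shift].
Qed.

Lemma Rintegral_shift h a b u : a <= b -> continuous h ->
  Rintegral mu `[a + u, b + u] h = Rintegral mu `[a, b] (fun x => h (x + u)).
Proof.
move=> ab ch; have shift' : derive1 (shift u : R -> R) = cst 1.
  by apply/funext => x; rewrite derive1E; exact: (congr1 (@^~ x) (derive_shift 1 u)).
have cshift : continuous (shift u : R -> R).
  by move=> x; apply: cvgD; [exact: cvg_id|exact: cvg_cst].
congr fine; rewrite (@integration_by_substitution_increasing R (shift u) h a b ab).
- by rewrite shift'; apply: eq_integral => x _; rewrite /= mulr1.
- by move=> x y _ _ xy; rewrite ltrD2r.
- by rewrite shift' => x _; exact: cst_continuous.
- by rewrite shift'; exact: is_cvg_cst.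
- by rewrite shift'; exact: is_cvg_cst.
- split.
  + by move=> x _; have [] := is_derive_shift x 1 u.
  + by apply: cvg_at_right_filter; exact: cshift.
  + by apply: cvg_at_left_filter; exact: cshift.
- exact: continuous_subspaceT.
Qed.

Lemma Rintegral_unit_periods h u n : continuous h ->
  Rintegral mu `[u, u + n%:R] h =
  Rintegral mu `[0, 1] (fun x => \sum_(0 <= i < n) h (x + (u + i%:R))).
Proof.
move=> ch; elim: n => [|n ih].
  rewrite addr0 set_itv1 Rintegral_set1.
  by under eq_Rintegral do rewrite big_nil; rewrite Rintegral_cst// mul0r.
rewrite (@Rintegral_itv_split _ u (u + n%:R) (u + n.+1%:R)); last 3 first.
- by rewrite lerDl.
- by rewrite lerD2l ler_nat.
- exact: continuous_integrable_itv.
rewrite ih -natr1 addrA -{1}[u + n%:R]add0r (addrC _ 1) Rintegral_shift// -RintegralD//.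
- by apply: eq_Rintegral => x _; rewrite big_nat_recr.
- by apply: continuous_integrable_itv; exact: continuous_shift_sum.
- by apply: continuous_integrable_itv; exact: continuous_comp_shift.
Qed.

Lemma Rintegral_le_shift_sum h u n (C : R) : continuous h ->
  (forall x, \sum_(0 <= i < n) h (x + (u + i%:R)) <= C) ->
  Rintegral mu `[u, u + n%:R] h <= C.
Proof.
move=> ch hC; rewrite Rintegral_unit_periods//.
apply: (@le_trans _ _ (Rintegral mu `[0, 1] (fun=> C))); last first.
  by rewrite Rintegral_itv_cst// subr0 mulr1.
apply: le_Rintegral => //; last exact: integrable_itv_cst.
by apply: continuous_integrable_itv; exact: continuous_shift_sum.
Qed.

Lemma ge0_integralT_le h (C : R) : continuous h -> (forall x, 0 <= h x) ->
  (forall n, Rintegral mu `[- n%:R, n%:R] h <= C) -> (\int[mu]_x (h x)%:E <= C%:E)%E.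
Proof.
move=> ch h0 hC; pose F n : set (measurableTypeR R) := `[- n%:R, n%:R]%classic.
have FT : \bigcup_n F n = setT := bigcup_itvT true false.
have cv : (\int[mu]_(x in F n) (h x)%:E)%E @[n --> \oo] --> (\int[mu]_x (h x)%:E)%E.
  rewrite -FT; apply: ge0_nondecreasing_set_cvg_integral.
  - move=> m n mn; rewrite subsetEset; apply: sub_itvcc; rewrite ?lerN2 ?ler_nat//.
  - by move=> n; exact: measurable_itv.
  - move=> n; apply/measurable_EFinP; apply: measurable_funTS.
    exact: continuous_measurable_fun.
  - by move=> n x _; rewrite lee_fin.
rewrite -(cvg_lim _ cv)//; apply: lime_le; first by apply/cvg_ex; eexists; exact: cv.
apply: nearW => n; have hi := continuous_integrable_itv (- n%:R) n%:R ch.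
by rewrite -[leLHS]fineK ?lee_fin; [exact: hC|exact: integrable_fin_num hi].
Qed.

Lemma fourier_integral_le g : square_integrable `[0, pi] g ->
  (\int[mu]_s (normc (fourier g s) ^+ 2)%:E <= (pi * sqr_L2norm `[0, pi] g)%:E)%E.
Proof.
move=> g2; have ch := continuous_sqr_fourier (square_integrable_cintegrable g2).
apply: ge0_integralT_le => // [s|n]; first exact: sqr_ge0.
have -> : `[- n%:R, n%:R : R] = `[- n%:R, - n%:R + (n + n)%:R].
  by rewrite natrD addKr.
apply: Rintegral_le_shift_sum => // x.
have := bessel (x - n%:R) (iota_uniq 0 (n + n)) g2.
by under eq_bigr do rewrite -addrA; rewrite /index_iota subn0.
Qed.

End Plancherel.

Section FreeWave.
Context {R : realType}.
Implicit Types (c al be : R[i]) (p y z : R -> R[i]) (x : R).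

Definition free_wave c al be x := al * cexp c x + be * cexp c (pi - x).

Lemma AC_cexp_rev c : AC (fun x => cexp c (pi - x)) (fun x => - c * cexp c (pi - x)).
Proof.
apply: eq_AC (AC_Z (cexp c pi) (AC_cexp (- c))) => x _; rewrite cexpD cexpNl//.
by rewrite mulrCA.
Qed.

Lemma normc_cexp_le1_itv c x : Re c <= 0 -> 0 <= x <= pi ->
  normc (cexp c x) <= 1 /\ normc (cexp c (pi - x)) <= 1.
Proof. by move=> c0 x0pi; split; apply: normc_cexp_le1; nra. Qed.

Lemma normc_free_wave_le c al be (A : R) x : Re c <= 0 -> 0 <= x <= pi ->
  normc al <= A -> normc be <= A -> normc (free_wave c al be x) <= 2 * A.
Proof.
move=> c0 /(normc_cexp_le1_itv c0)[cexp_le1 cexp_rev_le1] alA beA.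
rewrite (le_trans (le_normcD _ _))// mulr2n mulrDl mul1r lerD// Normc.normcM.
- by rewrite (le_trans _ alA)// ler_piMr.
- by rewrite (le_trans _ beA)// ler_piMr.
Qed.

Lemma sqr_free_wave c al be x : free_wave c al be x ^+ 2 =
  al ^+ 2 * cexp c x ^+ 2 + be ^+ 2 * cexp c (pi - x) ^+ 2 + 2 * al * be * cexp c pi.
Proof.
have -> : cexp c pi = cexp c x * cexp c (pi - x) by rewrite -cexpD addrC subrK.
by rewrite /free_wave; ring.
Qed.

Lemma cintegrable_cexp_sqr c p : cintegrable `[0, pi] p ->
  cintegrable `[0, pi] (fun x => p x * cexp c x ^+ 2) /\
  cintegrable `[0, pi] (fun x => p x * cexp c (pi - x) ^+ 2).
Proof.
by move=> pint; split; [apply: AC_cintegrableMr (AC_M (AC_cexp c) (AC_cexp c)) pint|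
  apply: AC_cintegrableMr (AC_M (AC_cexp_rev c) (AC_cexp_rev c)) pint].
Qed.

(* The constant part of the square of a free wave is annihilated by p. *)
Lemma cintegral_sqr_free_wave_le c p al be (A : R) :
  cintegrable `[0, pi] p -> cintegral `[0, pi] p = 0 -> normc al <= A -> normc be <= A ->
  normc (cintegral `[0, pi] (fun x => p x * free_wave c al be x ^+ 2)) <=
  A ^+ 2 * (normc (cintegral `[0, pi] (fun x => p x * cexp c x ^+ 2)) +
            normc (cintegral `[0, pi] (fun x => p x * cexp c (pi - x) ^+ 2))).
Proof.
move=> pint p0 alA beA; have [fwd_i bwd_i] := cintegrable_cexp_sqr c pint.
have -> : cintegral `[0, pi] (fun x => p x * free_wave c al be x ^+ 2) =
    al ^+ 2 * cintegral `[0, pi] (fun x => p x * cexp c x ^+ 2) +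
    be ^+ 2 * cintegral `[0, pi] (fun x => p x * cexp c (pi - x) ^+ 2) +
    2 * al * be * cexp c pi * cintegral `[0, pi] p.
  rewrite -!cintegralZ// -!cintegralD//; try exact: cintegrableZ.
    by apply: eq_cintegral => x _; rewrite sqr_free_wave; ring.
  by apply: cintegrableD => //; exact: cintegrableZ.
rewrite p0 mulr0 addr0 (le_trans (le_normcD _ _))// !Normc.normcM mulrDr.
have al0 := normc_ge0 al; have be0 := normc_ge0 be.
by rewrite lerD// ler_wpM2r// -expr2 ler_pXn2r ?nnegrE// (le_trans al0).
Qed.

Lemma normc_mulB_sqr_le (u v w : R[i]) (d B : R) :
  normc (u - w) <= d -> normc (v - w) <= d -> normc v <= 2 * B -> normc w <= B ->
  normc (u * v - w ^+ 2) <= 3 * B * d.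
Proof.
move=> uw vw vB wB; rewrite (_ : _ - _ = (u - w) * v + w * (v - w)); last by ring.
rewrite (le_trans (le_normcD _ _))// !Normc.normcM.
rewrite (_ : 3 * B * d = d * (2 * B) + B * d); last by ring.
by rewrite lerD// ler_pM.
Qed.

(* The product of two solutions differs by O(d) from the square of the free wave. *)
Lemma cintegral_product_le c p y z al be (d : R) : Re c <= 0 ->
  cintegrable `[0, pi] p -> cintegral `[0, pi] p = 0 ->
  cmeasurable_fun `[0, pi] y -> cmeasurable_fun `[0, pi] z ->
  normc al <= 5 / 2 -> normc be <= 5 / 2 ->
  normc_bounded `[0, pi] (fun x => y x - free_wave c al be x) d ->
  normc_bounded `[0, pi] (fun x => z x - free_wave c al be x) d ->
  normc_bounded `[0, pi] z 10 ->
  normc (cintegral `[0, pi] (fun x => p x * (y x * z x))) <=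
  25 / 4 * (normc (cintegral `[0, pi] (fun x => p x * cexp c x ^+ 2)) +
            normc (cintegral `[0, pi] (fun x => p x * cexp c (pi - x) ^+ 2))) +
  15 * d * L1norm `[0, pi] p.
Proof.
move=> c0 pint p0 my mz al_le be_le yd zd zb; set w := free_wave c al be.
have acw := AC_D (AC_Z al (AC_cexp c)) (AC_Z be (AC_cexp_rev c)).
have acw2 := AC_M acw acw; pose remainder x := y x * z x - w x ^+ 2.
have mrem : cmeasurable_fun `[0, pi] remainder.
  by apply: cmeasurableB; [exact: cmeasurableM|exact: AC_measurable acw2].
have rem_le : normc_bounded `[0, pi] remainder (15 * d).
  move=> x x0pi; rewrite (_ : 15 * d = 3 * 5 * d); last by ring.
  apply: (normc_mulB_sqr_le (yd x x0pi) (zd x x0pi)).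
    by rewrite (_ : 2 * 5 = 10 :> R); [exact: zb|ring].
  by apply: le_trans (normc_free_wave_le c0 x0pi al_le be_le) _; lra.
have wi : cintegrable `[0, pi] (fun x => p x * w x ^+ 2) := AC_cintegrableMr acw2 pint.
have remi := cintegrableMr (measurable_itv _) mrem rem_le pint.
have -> : cintegral `[0, pi] (fun x => p x * (y x * z x)) =
    cintegral `[0, pi] (fun x => p x * w x ^+ 2) +
    cintegral `[0, pi] (fun x => p x * remainder x).
  by rewrite -cintegralD//; apply: eq_cintegral => x _; rewrite /remainder; ring.
rewrite (le_trans (le_normcD _ _))// lerD//.
  rewrite (_ : 25 / 4 = (5 / 2) ^+ 2 :> R); first exact: cintegral_sqr_free_wave_le.
  by field.
rewrite mulrC; apply: le_trans (le_normc_cintegral (measurable_itv _) remi) _.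
exact: L1normMr_le.
Qed.

End FreeWave.

Section WeylDifference.
Context {R : realType} {N : nat}.
Implicit Types (c : R[i]) (q qt y dy z dz : 'I_N -> R -> R[i]) (j k : 'I_N) (Q : R).

Lemma edge_wronskian c (q qt y dy z dz : R -> R[i]) :
  edge_solution c (fun x => q x * y x) y dy ->
  edge_solution c (fun x => qt x * z x) z dz ->
  (y pi * dz pi - dy pi * z pi) - (y 0 * dz 0 - dy 0 * z 0) =
  cintegral `[0, pi] (fun x => (qt x - q x) * (y x * z x)).
Proof.
move=> [acy acdy] [acz acdz]; have acW := AC_B (AC_M acy acdz) (AC_M acdy acz).
rewrite (AC_increment acW) ?pi_ge0//.
by apply: eq_cintegral => x _; ring.
Qed.

Lemma star_wronskian c k q qt y dy z dz : val k != 0%N ->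
  star_solution c 1 k (potential_mul q y) y dy ->
  star_solution c 1 k (potential_mul qt z) z dz ->
  dy k 0 - dz k 0 =
  \sum_j cintegral `[0, pi] (fun x => (qt j x - q j x) * (y j x * z j x)).
Proof.
move=> k0 [esy [Y hY] fluxy endy] [esz [Z hZ] fluxz endz].
pose vertex_term j := vertex_value y j * vertex_flux dz j - vertex_flux dy j * vertex_value z j.
pose end_term j := end_value y j * end_flux dz j - end_flux dy j * end_value z j.
have edge j : cintegral `[0, pi] (fun x => (qt j x - q j x) * (y j x * z j x)) =
    vertex_term j - end_term j.
  rewrite -(edge_wronskian (esy j) (esz j)) /vertex_term /end_term.
  by rewrite /vertex_value /end_value /vertex_flux /end_flux; case: ifP => _; ring.
have vertex_sum : \sum_j vertex_term j = 0.
  rewrite /vertex_term; under eq_bigr do rewrite hY hZ.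
  by rewrite sumrB -mulr_sumr -mulr_suml fluxy fluxz mulr0 mul0r subrr.
rewrite (eq_bigr _ (fun j _ => edge j)) sumrB vertex_sum sub0r (bigD1 k)//= big1.
  by rewrite /end_term endy endz eqxx /end_flux (negbTE k0) /= mulr1n; ring.
by move=> j jk; rewrite /end_term endy endz (negbTE jk) !mulr0 mul0r subrr.
Qed.

Lemma star_free_expansion c k y dy j : half_damped c ->
  star_solution c 1 k (fun _ _ => 0) y dy ->
  exists al be, [/\ normc al <= 5 / 2, normc be <= 5 / 2 &
    forall x, 0 <= x <= pi -> y j x = free_wave c al be x].
Proof.
move=> damped ss; have [es _ _ _] := ss; have c_neq0 := half_damped_neq0 damped.
have c0 := ltW (half_damped_Re_lt0 damped); have c_gt0 : 0 < normc c by rewrite normc_gt0.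
have L0 : L1norm `[0, pi] (fun=> 0 : R[i]) = 0.
  by rewrite /L1norm Rintegral_cst// Normc.normc0 mul0r.
have L0_le (i : 'I_N) : L1norm `[0, pi] (fun=> 0 : R[i]) <= 0 by rewrite L0.
have := star_waves_le damped ss L0_le j; rewrite Normc.normc1 mulr1 mulr0 addr0.
set l := lwave _ _ _; set r := rwave _ _ _ => -[lpi_le r0_le].
have half_le (w : R[i]) : normc w <= 5 * normc c -> normc ((2 * c)^-1 * w) <= 5 / 2.
  move=> w_le; rewrite Normc.normcM Normc.normcV Normc.normcM normc_nat.
  by rewrite mulrC ler_pdivrMr ?mulr_gt0// mulrA divfK.
exists ((2 * c)^-1 * r 0), ((2 * c)^-1 * - l pi).
split; [exact: half_le|by apply: half_le; rewrite normcN|move=> x x0pi].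
have rx : r x = cexp c x * r 0.
  by have := rwave_le (es j) c0 x0pi; rewrite L0 normc_le0 subr_eq0 => /eqP.
have lx : l x = cexp c (pi - x) * l pi.
  by have := lwave_le (es j) c0 x0pi; rewrite L0 normc_le0 subr_eq0 => /eqP.
transitivity ((2 * c)^-1 * (r x - l x)).
  by rewrite /r /l /rwave /lwave; field; rewrite c_neq0.
by rewrite rx lx /free_wave; ring.
Qed.

Lemma star_difference_le c k q qt y dy z dz Q :
  half_damped c -> 17 * Q <= normc c -> val k != 0%N ->
  (forall j, cintegrable `[0, pi] (q j)) -> (forall j, cintegrable `[0, pi] (qt j)) ->
  (forall j, L1norm `[0, pi] (q j) <= Q) -> (forall j, L1norm `[0, pi] (qt j) <= Q) ->
  (forall j, cintegral `[0, pi] (fun x => qt j x - q j x) = 0) ->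
  star_solution c 1 k (potential_mul q y) y dy ->
  star_solution c 1 k (potential_mul qt z) z dz ->
  normc (dy k 0 - dz k 0) <=
  \sum_j (25 / 4 *
      (normc (cintegral `[0, pi] (fun x => (qt j x - q j x) * cexp c x ^+ 2)) +
       normc (cintegral `[0, pi] (fun x => (qt j x - q j x) * cexp c (pi - x) ^+ 2))) +
    15 * (85 * Q / normc c) * L1norm `[0, pi] (fun x => qt j x - q j x)).
Proof.
move=> damped Qc k0 qi qti qQ qtQ mean0 ssy ssz.
have [y0 [dy0 ss0]] : exists y0 dy0, star_solution c 1 k (fun _ _ => 0) y0 dy0.
  by apply: star_solution_exists => // j; have [] := AC_cst (0 : R[i]).
have [esy _ _ _] := ssy; have [esz _ _ _] := ssz.
rewrite (star_wronskian k0 ssy ssz) (le_trans (ler_normc_sum _ _ _))//.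
apply: ler_sum => j _; have [al [be [al_le be_le y0E]]] := star_free_expansion j damped ss0.
apply: cintegral_product_le (mean0 j) _ _ al_le be_le _ _ _.
- exact: ltW (half_damped_Re_lt0 damped).
- exact: cintegrableB.
- exact: AC_measurable (esy j).1.
- exact: AC_measurable (esz j).1.
- move=> x x0pi; rewrite -y0E//; have := star_free_close damped qi qQ Qc ssy ss0 j x0pi.
  by rewrite Normc.normc1 mulr1.
- move=> x x0pi; rewrite -y0E//; have := star_free_close damped qti qtQ Qc ssz ss0 j x0pi.
  by rewrite Normc.normc1 mulr1.
- by have := star_potential_le damped qti qtQ Qc ssz j; rewrite Normc.normc1 mulr1.
Qed.

End WeylDifference.

Section LineHeight.
Context {R : realType}.
Implicit Types (N : nat) (r : R).

Lemma expr8D3_le N : (2 <= N)%N -> 8 ^+ N + 3 ^+ N.-1 <= (33 / 4) ^+ N :> R.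
Proof.
case: N => [|[|N]]// _; elim: N => [|N ih]; first by rewrite !expr2 expr1; lra.
rewrite (exprS 8) (exprS (33 / 4)) [N.+3.-1]/= (exprS 3 N.+1).
have : 0 <= 8 ^+ N.+2 :> R by rewrite exprn_ge0.
have : 0 <= 3 ^+ N.+1 :> R by rewrite exprn_ge0.
move: ih; rewrite /=; move: (8 ^+ N.+2 : R) (3 ^+ N.+1 : R) ((33 / 4) ^+ N.+2 : R).
by move=> *; lra.
Qed.

Lemma powR_exprnK N (a : R) : (0 < N)%N -> 0 <= a -> (a ^+ N) `^ N%:R^-1 = a.
Proof.
by move=> N0 a0; rewrite -powR_mulrn// -powRrM mulfV ?powRr1// pnatr_eq0 -lt0n.
Qed.

Lemma root_expr8D3_gap N : (2 <= N)%N ->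
  0 < (8 ^+ N + 3 ^+ N.-1 : R) `^ N%:R^-1 - 8 <= 1 / 4.
Proof.
move=> N2; have N0 := ltnW N2; have Ninv : 0 < N%:R^-1 :> R by rewrite invr_gt0 ltr0n.
set X := 8 ^+ N + _; have X0 : 0 < X by rewrite addr_gt0 ?exprn_gt0.
apply/andP; split.
- rewrite subr_gt0 -[ltLHS](powR_exprnK N0)//; apply: gt0_ltr_powR => //.
  + by rewrite nnegrE exprn_ge0.
  + by rewrite nnegrE ltW.
  + by rewrite ltrDl exprn_gt0.
- rewrite lerBlDr (_ : 1 / 4 + 8 = 33 / 4 :> R); last by lra.
  rewrite -[leRHS](powR_exprnK N0); last by lra.
  apply: ge0_ler_powR; rewrite ?nnegrE ?(ltW X0) ?(ltW Ninv)//.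
  exact: expr8D3_le.
Qed.

Lemma ln4_le_line_height N r : ln 4 / (2 * pi) <= line_height N r.
Proof. by rewrite le_max lexx. Qed.

Lemma line_height_gt0 N r : 0 < line_height N r.
Proof.
apply: lt_le_trans (ln4_le_line_height N r).
by rewrite divr_gt0 ?mulr_gt0 ?pi_gt0// ln_gt0// ltr1n.
Qed.

Lemma expR_line_height_le N r : expR (- line_height N r * pi) <= 1 / 2.
Proof.
rewrite -ler_sqr ?nnegrE ?expR_ge0// -expRM_natl.
have -> : (1 / 2) ^+ 2 = expR (- ln 4) :> R by rewrite expRN lnK ?posrE//; field.
rewrite ler_expR mulNr mulrN lerN2 mulrCA -ler_pdivrMr ?mulr_gt0 ?pi_gt0//.
exact: ln4_le_line_height.
Qed.

Lemma le_line_height N r : (2 <= N)%N -> 0 < r ->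
  17 * (Num.sqrt pi * r) <= line_height N r.
Proof.
move=> N2 r0; have /andP[gap_gt0 gap_le] := root_expr8D3_gap N2.
have p0 : 0 < pi :> R := pi_gt0 R.
rewrite /line_height le_max; apply/orP; right; rewrite ler_pdivlMr//.
set S := Num.sqrt pi; set S2 := Num.sqrt (2 * pi); set T := 24 * _ * _ * _.
have Sr0 : 0 <= S * r by rewrite mulr_ge0 ?sqrtr_ge0// ltW.
have S_le : S <= S2 by apply: ler_wsqrtr; lra.
have T0 : 0 <= T by rewrite !mulr_ge0 ?expR_ge0 ?sqr_ge0// ltW.
apply: (@le_trans _ _ (17 * (S * r) * (1 / 4))); first by rewrite ler_wpM2l// mulr_ge0.
have : r * (2 * S) <= r * (S + S2 + T) by rewrite ler_wpM2l ?(ltW r0)//; lra.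
lra.
Qed.

End LineHeight.

Section IntegralMajorant.
Context {R : realType}.
Notation mu := (@lebesgue_measure R).
Implicit Types (f g : R -> R) (C D k : R).

(* The majorised function need not be measurable: the integral of a nonnegative
   function is a supremum over the simple functions below it. *)
Lemma ge0_le_integralT (f g : R -> \bar R) : (forall x, (0 <= f x)%E) ->
  (forall x, (f x <= g x)%E) -> (\int[mu]_x f x <= \int[mu]_x g x)%E.
Proof.
move=> f0 fg; have g0 x : (0 <= g x)%E by exact: le_trans (f0 x) (fg x).
rewrite !ge0_integralTE//; apply: ereal_sup_le => _ [h /= hf <-]; exists h => //= x.
exact: le_trans (hf x) (fg x).
Qed.

Definition integral_le f C :=
  [/\ measurable_fun (setT : set (measurableTypeR R)) f, forall x, 0 <= f x &
      (\int[mu]_x (f x)%:E <= C%:E)%E].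

Lemma integral_leD f g C D : integral_le f C -> integral_le g D ->
  integral_le (fun x => f x + g x) (C + D).
Proof.
move=> [mf f0 fC] [mg g0 gD]; split; first exact: measurable_funD.
  by move=> x; rewrite addr_ge0.
under eq_integral do rewrite EFinD.
rewrite ge0_integralD//; first by rewrite EFinD leeD.
all: by [move=> x _; rewrite lee_fin|exact/measurable_EFinP].
Qed.

Lemma integral_leZ f C k : 0 <= k -> integral_le f C ->
  integral_le (fun x => k * f x) (k * C).
Proof.
move=> k0 [mf f0 fC]; split; first exact: measurable_funM.
  by move=> x; rewrite mulr_ge0.
under eq_integral do rewrite EFinM.
rewrite ge0_integralZl_EFin//; first by rewrite EFinM lee_wpmul2l.
all: by [move=> x _; rewrite lee_fin|exact/measurable_EFinP].
Qed.

Lemma integral_le_sum (I : Type) (s : seq I) (f : I -> R -> R) (C : I -> R) :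
  (forall i, integral_le (f i) (C i)) ->
  integral_le (fun x => \sum_(i <- s) f i x) (\sum_(i <- s) C i).
Proof.
move=> fC; elim: s => [|i s ih].
  under eq_fun do rewrite big_nil; rewrite big_nil.
  by split => //; rewrite integral0.
by under eq_fun do rewrite big_cons; rewrite big_cons; exact: integral_leD.
Qed.

Lemma integral_le_oneDsqrV : integral_le (fun x => (oneDsqr x)^-1) pi.
Proof.
have f0 (x : R) : 0 <= (oneDsqr x)^-1 by rewrite invr_ge0 (le_trans ler01)// oneDsqr_ge1.
split => //; first exact: continuous_measurable_fun continuous_oneDsqrV.
rewrite ge0_symfun_integralT//; last by move=> x; rewrite /= /oneDsqr sqrrN.
  by rewrite -set_itvcy integral0y_oneDsqr -EFinM lee_fin; lra.
exact: continuous_oneDsqrV.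
Qed.

Lemma integral_le_fourier (g : R -> R[i]) : square_integrable `[0, pi] g ->
  integral_le (fun s => normc (fourier g s) ^+ 2) (pi * sqr_L2norm `[0, pi] g).
Proof.
move=> g2; split; last exact: fourier_integral_le.
  apply: continuous_measurable_fun; apply: continuous_sqr_fourier.
  exact: square_integrable_cintegrable.
by move=> s; exact: sqr_ge0.
Qed.

Lemma integral_leW f C D : C <= D -> integral_le f C -> integral_le f D.
Proof. by move=> CD [mf f0 fC]; split => //; apply: le_trans fC _; rewrite lee_fin. Qed.

Lemma integral_le_majorised f g C : (forall x, 0 <= f x) -> (forall x, f x <= g x) ->
  integral_le g C -> (\int[mu]_x (f x)%:E <= C%:E)%E.
Proof.
move=> f0 fg [_ _]; apply: le_trans; apply: ge0_le_integralT => x; first by rewrite lee_fin.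
by rewrite lee_fin.
Qed.

Lemma sqr_sum_le {I : finType} (a : I -> R) :
  (\sum_i a i) ^+ 2 <= #|I|%:R * \sum_i a i ^+ 2.
Proof.
have [I0|I0] := posnP #|I|.
  by rewrite !big1 ?expr0n ?mulr0// => i; have := fintype0 i I0.
set S := \sum_i a i; set n : R := #|I|%:R; have n0 : 0 < n by rewrite ltr0n.
have : 0 <= \sum_i (n * a i - S) ^+ 2 by apply: sumr_ge0 => i _; exact: sqr_ge0.
have -> : \sum_i (n * a i - S) ^+ 2 = n * (n * \sum_i a i ^+ 2 - S ^+ 2).
  transitivity (\sum_i (n ^+ 2 * a i ^+ 2 - 2 * n * S * a i + S ^+ 2)).
    by apply: eq_bigr => i _; ring.
  rewrite big_split/= sumrB -!mulr_sumr -/S sumr_const -mulr_natl -/n; ring.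
by rewrite pmulr_rge0// subr_ge0.
Qed.

Lemma L2norm_le (D : set R) (f : R -> R[i]) C : 0 <= C ->
  (\int[mu]_(x in D) (normc (f x) ^+ 2)%:E <= (C ^+ 2)%:E)%E -> (L2norm D f <= C%:E)%E.
Proof.
move=> C0 fC; have int_ge0 : (0 <= \int[mu]_(x in D) (normc (f x) ^+ 2)%:E)%E.
  by apply: integral_ge0 => x _; rewrite lee_fin sqr_ge0.
rewrite /L2norm poweR12_sqrt//; move: fC int_ge0.
case: (integral _ _ _) => [t| |]//; rewrite !lee_fin => tC t0.
by rewrite -(ger0_norm C0) -sqrtr_sqr ler_wsqrtr.
Qed.

End IntegralMajorant.

Section Attenuation.
Context {R : realType}.
Implicit Types (p : R -> R[i]) (w : R -> R) (b s x : R).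

Definition attenuated w p x : R[i] := Complex (expR (- w x)) 0 * p x.

Lemma attenuated_le w p : continuous w -> (forall x, 0 <= x <= pi -> 0 <= w x) ->
  square_integrable `[0, pi] p -> square_integrable `[0, pi] (attenuated w p) /\
  sqr_L2norm `[0, pi] (attenuated w p) <= sqr_L2norm `[0, pi] p.
Proof.
move=> cw w0 p2; apply: square_integrable_le => // [|x].
  apply: cmeasurableM p2.1; split; last exact: measurable_cst.
  apply: measurable_funTS; apply: continuous_measurable_fun => x.
  by apply: continuous_comp; [exact: (continuousN (@cw x))|exact: continuous_expR].
rewrite /= in_itv/= => /w0 wx0.
by rewrite Normc.normcM normc_real ger0_norm ?expR_ge0// ler_piMl// -expR0 ler_expR oppr_le0.
Qed.

Lemma fourier_attenuated_integral_le w p : continuous w ->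
  (forall x, 0 <= x <= pi -> 0 <= w x) -> square_integrable `[0, pi] p ->
  integral_le (fun s => normc (fourier (attenuated w p) s) ^+ 2) (pi * sqr_L2norm `[0, pi] p).
Proof.
move=> cw w0 /(attenuated_le cw w0)[a2 aS].
by apply: integral_leW (integral_le_fourier a2); rewrite ler_wpM2l ?pi_ge0.
Qed.

Definition forward_damped b p := attenuated (fun x => 2 * b * x) p.

Definition backward_damped b p :=
  attenuated (fun x => 2 * b * (pi - x)) (fun x => conjc (p x)).

Lemma fourier_forward_damped_le b p : 0 <= b -> square_integrable `[0, pi] p ->
  integral_le (fun s => normc (fourier (forward_damped b p) s) ^+ 2)
    (pi * sqr_L2norm `[0, pi] p).
Proof.
move=> b0; apply: fourier_attenuated_integral_le => [|x x0pi]; last by nra.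
exact: mulrl_continuous.
Qed.

Lemma fourier_backward_damped_le b p : 0 <= b -> square_integrable `[0, pi] p ->
  integral_le (fun s => normc (fourier (backward_damped b p) s) ^+ 2)
    (pi * sqr_L2norm `[0, pi] p).
Proof.
move=> b0 p2; have [pc2 pcS] : square_integrable `[0, pi] (fun x => conjc (p x)) /\
    sqr_L2norm `[0, pi] (fun x => conjc (p x)) <= sqr_L2norm `[0, pi] p.
  apply: square_integrable_le => //; first exact: cmeasurable_conjc p2.1.
  by move=> x _; rewrite normc_conjc.
apply: (@integral_leW _ _ (pi * sqr_L2norm `[0, pi] (fun x => conjc (p x)))).
  by rewrite ler_wpM2l ?pi_ge0.
apply: fourier_attenuated_integral_le pc2 => x; last by move=> x0pi; nra.
by apply: cvgM; [exact: cvg_cst|apply: cvgB; [exact: cvg_cst|exact: cvg_id]].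
Qed.

Lemma sqr_cexp_osc b s x :
  cexp (Complex (- b) s) x ^+ 2 = Complex (expR (- (2 * b * x))) 0 * osc s x.
Proof.
rewrite expr2 -cexpDl (_ : _ + _ = Complex (- (2 * b)) 0 + Complex 0 (2 * s)).
  by rewrite cexpDl; congr (_ * _); rewrite /cexp/= mul0r cos0 sin0 mulr0 mulr1 mulNr.
by apply: complex_ext => /=; ring.
Qed.

Lemma cintegral_sqr_cexp p b s :
  cintegral `[0, pi] (fun x => p x * cexp (Complex (- b) s) x ^+ 2) =
  fourier (forward_damped b p) s.
Proof.
apply: eq_cintegral => x _.
by rewrite sqr_cexp_osc /forward_damped /attenuated; ring.
Qed.

Lemma normc_cintegral_sqr_cexp_rev p b s : cintegrable `[0, pi] p ->
  normc (cintegral `[0, pi] (fun x => p x * cexp (Complex (- b) s) (pi - x) ^+ 2)) =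
  normc (fourier (backward_damped b p) s).
Proof.
move=> pint; have [_ rev_i] := cintegrable_cexp_sqr (Complex (- b) s) pint.
have -> : fourier (backward_damped b p) s =
    osc s pi * conjc (cintegral `[0, pi] (fun x => p x * cexp (Complex (- b) s) (pi - x) ^+ 2)).
  rewrite -cintegral_conjc// -cintegralZ//; last exact: cintegrable_conjc.
  apply: eq_cintegral => x _; rewrite sqr_cexp_osc !conjcM conjc_osc oscN opprB.
  have -> : osc s x = osc s pi * osc s (x - pi) by rewrite /osc -cexpD addrC subrK.
  by rewrite /backward_damped /attenuated/= oppr0; ring.
by rewrite Normc.normcM normc_osc mul1r normc_conjc.
Qed.

End Attenuation.

Section WeylFunction.
Context {R : realType} {N : nat}.
Implicit Types (q : 'I_N -> R -> R[i]) (p : R -> R[i]) (j k : 'I_N) (b s Q : R).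

Lemma weyl_function_solution q k (c : R[i]) : val k != 0%N ->
  (forall j, cmeasurable_fun `[0, pi] (q j)) ->
  (exists y dy, star_solution c 1 k (potential_mul q y) y dy) ->
  exists y dy, star_solution c 1 k (potential_mul q y) y dy /\
    weyl_function q k (- c ^+ 2) = dy k 0.
Proof.
move=> k0 mq [y [dy /(weyl_solutionP _ _ _ k0 mq) ws]].
have : exists m, [set m | exists y dy, weyl_solution q k (- c ^+ 2) y dy /\ m = dy k 0] m.
  by exists (dy k 0), y, dy.
move=> /(xgetPex 0)[y' [dy' [/(weyl_solutionP _ _ _ k0 mq) ss wE]]].
by exists y', dy'.
Qed.

Lemma sqr_spectral_parameter b s : Complex s b ^+ 2 = - Complex (- b) s ^+ 2.
Proof. by rewrite !expr2; apply: complex_ext => /=; ring. Qed.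

Definition edge_term b Q p s :=
  25 / 4 * (normc (fourier (forward_damped b p) s) + normc (fourier (backward_damped b p) s)) +
  15 * (85 * Q / normc (Complex (- b) s)) * L1norm `[0, pi] p.

Definition edge_constant b Q : R :=
  3 * (25 / 4) ^+ 2 * (2 * pi) + 3 * (15 * (85 * Q)) ^+ 2 * pi * (1 + (b ^+ 2)^-1) * pi.

Lemma edge_constant_gt0 b Q : 0 < edge_constant b Q.
Proof.
rewrite ltr_wpDr//; last by rewrite !mulr_gt0 ?exprn_gt0 ?pi_gt0//; lra.
have c0 : 0 <= 3 * (15 * (85 * Q)) ^+ 2 :> R by rewrite mulr_ge0// sqr_ge0.
by rewrite mulr_ge0 ?pi_ge0// mulr_ge0 ?addr_ge0 ?invr_ge0 ?sqr_ge0// mulr_ge0 ?pi_ge0.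
Qed.

Lemma sqr_normcV_le b s : 0 < b ->
  (normc (Complex (- b) s) ^+ 2)^-1 <= (1 + (b ^+ 2)^-1) * (oneDsqr s)^-1.
Proof.
move=> b0; have b2 : 0 < b ^+ 2 by rewrite exprn_gt0.
have o0 : 0 < oneDsqr s by rewrite (lt_le_trans ltr01)// oneDsqr_ge1.
have n0 : 0 < b ^+ 2 + s ^+ 2 by rewrite ltr_wpDr// sqr_ge0.
rewrite sqr_normcE/= sqrrN ler_pdivlMr// ler_pdivrMl// /oneDsqr.
have -> : (b ^+ 2 + s ^+ 2) * (1 + (b ^+ 2)^-1) = b ^+ 2 + s ^+ 2 + 1 + s ^+ 2 / b ^+ 2.
  by field; rewrite gt_eqF.
have quot_ge0 : 0 <= s ^+ 2 / b ^+ 2 by rewrite divr_ge0 ?sqr_ge0.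
lra.
Qed.

Lemma sqr_sum3_le (u v w : R) : (u + v + w) ^+ 2 <= 3 * (u ^+ 2 + v ^+ 2 + w ^+ 2).
Proof.
by have := sqr_ge0 (u - v); have := sqr_ge0 (v - w); have := sqr_ge0 (u - w); nra.
Qed.

Definition edge_majorant b Q p s :=
  3 * (25 / 4) ^+ 2 * (normc (fourier (forward_damped b p) s) ^+ 2 +
                       normc (fourier (backward_damped b p) s) ^+ 2) +
  3 * (15 * (85 * Q)) ^+ 2 * (pi * sqr_L2norm `[0, pi] p) * (1 + (b ^+ 2)^-1) * (oneDsqr s)^-1.

Lemma sqr_edge_term_le b Q p s : 0 < b -> square_integrable `[0, pi] p ->
  edge_term b Q p s ^+ 2 <= edge_majorant b Q p s.
Proof.
move=> b0 p2; rewrite /edge_term /edge_majorant; set K := 15 * (85 * Q).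
set u := normc (fourier (forward_damped _ _) _); set v := normc (fourier _ _).
set n := normc _; set I := L1norm _ _; set S := sqr_L2norm _ _.
have I_le : I ^+ 2 <= pi * S by have := sqr_L1norm_le (pi_gt0 R) p2; rewrite subr0.
have : I ^+ 2 * (n ^+ 2)^-1 <= pi * S * ((1 + (b ^+ 2)^-1) * (oneDsqr s)^-1).
  by apply: ler_pM I_le (sqr_normcV_le s b0); rewrite ?invr_ge0 sqr_ge0.
move/(ler_wpM2l (sqr_ge0 K)) => remainder_le.
have -> : 25 / 4 * (u + v) + 15 * (85 * Q / n) * I = 25 / 4 * u + 25 / 4 * v + K * I / n.
  by rewrite /K; ring.
apply: (le_trans (sqr_sum3_le _ _ _)).
rewrite expr_div_n [(K * I) ^+ 2]exprMn; lra.
Qed.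

Lemma edge_majorant_integral_le b Q p : 0 < b -> square_integrable `[0, pi] p ->
  integral_le (edge_majorant b Q p) (edge_constant b Q * sqr_L2norm `[0, pi] p).
Proof.
move=> b0 p2; set S := sqr_L2norm _ _; rewrite /edge_majorant -/S.
set wave_cst := 3 * (25 / 4) ^+ 2; set remainder_cst := _ * (1 + _).
have -> : edge_constant b Q * S = wave_cst * (pi * S + pi * S) + remainder_cst * pi.
  by rewrite /wave_cst /remainder_cst /edge_constant; move: (pi : R) => P; ring.
apply: integral_leD; apply: integral_leZ.
- by rewrite mulr_ge0// sqr_ge0.
- apply: integral_leD; first exact: fourier_forward_damped_le (ltW b0) p2.
  exact: fourier_backward_damped_le (ltW b0) p2.
- have K2 : 0 <= 3 * (15 * (85 * Q)) ^+ 2 :> R by rewrite mulr_ge0// sqr_ge0.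
  rewrite mulr_ge0 ?addr_ge0 ?invr_ge0 ?sqr_ge0// mulr_ge0// mulr_ge0 ?pi_ge0//.
  exact: sqr_L2norm_ge0.
- exact: integral_le_oneDsqrV.
Qed.

End WeylFunction.

Section Potential.
Context {R : realType} {N : nat}.
Implicit Types (q qt : 'I_N -> R -> R[i]) (j : 'I_N) (r D : R).

Lemma potential_square_integrable q : potential q ->
  forall j, square_integrable `[0, pi] (q j).
Proof. by move=> pq j; have [] := inL2_square_integrable (pq j). Qed.

Lemma potentialB q qt : potential q -> potential qt ->
  potential (fun j x => q j x - qt j x).
Proof.
move=> pq pqt j; apply: square_integrable_inL2; apply: square_integrableB => //;
  exact: potential_square_integrable.
Qed.

Lemma potential_norm_finite q : potential q ->
  exists2 D, 0 <= D & potential_norm q = D%:E.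
Proof.
move=> pq; have norm_ge0 : (0 <= potential_norm q)%E by exact: bigmax_ge_id.
exists (fine (potential_norm q)); first exact: fine_ge0.
rewrite fineK// ge0_fin_numE//; apply: bigmax_lt => // j _.
by have [] := pq j.
Qed.

Lemma sqr_L2norm_potential_le q D j : potential q -> (potential_norm q <= D%:E)%E ->
  sqr_L2norm `[0, pi] (q j) <= D ^+ 2.
Proof.
move=> pq qD; have [_ L2E] := inL2_square_integrable (pq j).
have : (L2norm `]0%R, pi[ (q j) <= D%:E)%E.
  by apply: le_trans qD; exact: (le_bigmax _ (fun j => L2norm `]0, pi[ (q j))).
rewrite L2E lee_fin => sqrt_le; rewrite -(sqr_sqrtr (sqr_L2norm_ge0 _ (q j))).
by rewrite ler_sqr ?nnegrE ?sqrtr_ge0// (le_trans _ sqrt_le) ?sqrtr_ge0.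
Qed.

Lemma L1norm_potential_le q r j : 0 <= r -> potential q -> (potential_norm q <= r%:E)%E ->
  L1norm `[0, pi] (q j) <= Num.sqrt pi * r.
Proof.
move=> r0 pq qr; rewrite -ler_sqr ?nnegrE ?L1norm_ge0 ?mulr_ge0 ?sqrtr_ge0//.
rewrite exprMn sqr_sqrtr ?pi_ge0//.
apply: (le_trans (sqr_L1norm_le (pi_gt0 R) (potential_square_integrable pq j))).
by rewrite subr0 ler_wpM2l ?pi_ge0// sqr_L2norm_potential_le.
Qed.

Lemma omega_eq_mean0 q qt : potential q -> potential qt ->
  (forall j, omega q j = omega qt j) ->
  forall j, cintegral `[0, pi] (fun x => qt j x - q j x) = 0.
Proof.
move=> pq pqt om j; have two_inv : (2^-1 : R[i]) != 0 by rewrite invr_eq0 pnatr_eq0.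
have qi := square_integrable_cintegrable (potential_square_integrable pq j).
have qti := square_integrable_cintegrable (potential_square_integrable pqt j).
rewrite cintegralB// -!cintegral_itv_oo_cc//; apply/eqP; rewrite subr_eq0; apply/eqP.
by have := om j => /(mulfI two_inv) ->.
Qed.

End Potential.

Section WeylDistance.
Context {R : realType} {N : nat}.
Variables (b Q : R) (q qt : 'I_N -> R -> R[i]) (k : 'I_N).
Hypotheses (b0 : 0 < b) (Eb : expR (- b * pi) <= 1 / 2) (Qb : 17 * Q <= b)
  (k0 : val k != 0%N)
  (q2 : forall j, square_integrable `[0, pi] (q j))
  (qt2 : forall j, square_integrable `[0, pi] (qt j))
  (qQ : forall j, L1norm `[0, pi] (q j) <= Q) (qtQ : forall j, L1norm `[0, pi] (qt j) <= Q)
  (mean0 : forall j, cintegral `[0, pi] (fun x => qt j x - q j x) = 0).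

Lemma weyl_difference_le (s : R) :
  normc (weyl_function q k (Complex s b ^+ 2) - weyl_function qt k (Complex s b ^+ 2)) <=
  \sum_j edge_term b Q (fun x => qt j x - q j x) s.
Proof.
set c : R[i] := Complex (- b) s.
have b_le : b <= normc c by have := ler_Re_normc c; rewrite /c/= normrN gtr0_norm.
have damped : half_damped c by rewrite /half_damped normc_cexp.
have Qc := le_trans Qb b_le.
have qi j := square_integrable_cintegrable (q2 j).
have qti j := square_integrable_cintegrable (qt2 j).
have [y [dy [ssy wy]]] := weyl_function_solution k0 (fun j => (q2 j).1)
  (star_potential_exists k damped qi qQ Qc 1).
have [z [dz [ssz wz]]] := weyl_function_solution k0 (fun j => (qt2 j).1)
  (star_potential_exists k damped qti qtQ Qc 1).
rewrite sqr_spectral_parameter wy wz.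
apply: le_trans (star_difference_le damped Qc k0 qi qti qQ qtQ mean0 ssy ssz) _.
apply: ler_sum => j _; have pj := cintegrableB (measurable_itv _) (qti j) (qi j).
by rewrite /edge_term cintegral_sqr_cexp (normc_cintegral_sqr_cexp_rev _ _ pj) lexx.
Qed.

Lemma weyl_difference_L2_le (D : R) : 0 <= D ->
  (forall j, sqr_L2norm `[0, pi] (fun x => qt j x - q j x) <= D ^+ 2) ->
  (L2norm setT (fun s => weyl_function q k (Complex s b ^+ 2) -
                         weyl_function qt k (Complex s b ^+ 2))%R <=
   (N%:R * Num.sqrt (edge_constant b Q) * D)%:E)%E.
Proof.
move=> D0 pD; have K0 := ltW (edge_constant_gt0 b Q).
have p2 j := square_integrableB (measurable_itv _) (qt2 j) (q2 j).
apply: L2norm_le; first by rewrite !mulr_ge0 ?sqrtr_ge0.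
apply: (@integral_le_majorised _ _
  (fun s => N%:R * \sum_j edge_majorant b Q (fun x => qt j x - q j x) s)).
- by move=> s; exact: sqr_ge0.
- move=> s; have := weyl_difference_le s; rewrite -ler_sqr ?nnegrE//; last first.
    exact: le_trans (weyl_difference_le s).
  move=> /le_trans; apply; apply: (le_trans (sqr_sum_le _)); rewrite card_ord.
  by rewrite ler_wpM2l//; apply: ler_sum => j _; exact: sqr_edge_term_le.
- apply: (integral_leW _ (integral_leZ (ler0n R N) (integral_le_sum (index_enum _)
    (fun j => edge_majorant_integral_le Q b0 (p2 j))))).
  rewrite !exprMn sqr_sqrtr// expr2 -!mulrA ler_wpM2l// -mulr_sumr mulrCA ler_wpM2l//.
  apply: (@le_trans _ _ (\sum_(j < N) D ^+ 2)); first exact: ler_sum.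
  by rewrite sumr_const card_ord mulr_natl.
Qed.

End WeylDistance.

Theorem theorem2 (R : realType) (N : nat) (hN : (2 <= N)%N) (r : R)
    (hr : 0 < r) :
  exists A : R, 0 < A /\
    forall q qt : 'I_N -> R -> R[i],
      potential q -> potential qt ->
      (forall j : 'I_N, omega q j = omega qt j) ->
      (potential_norm q < r%:E)%E ->
      (potential_norm qt < r%:E)%E ->
      (weyl_dist (line_height N r) q qt <=
         A%:E * potential_norm (fun j x => q j x - qt j x)%R)%E.
Proof.
pose b := line_height N r; pose Q := Num.sqrt pi * r.
exists (N%:R * Num.sqrt (edge_constant b Q)); split.
  by rewrite mulr_gt0 ?sqrtr_gt0 ?edge_constant_gt0// ltr0n ltnW.
move=> q qt pq pqt om /ltW nq /ltW nqt; have pd := potentialB pq pqt.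
have [D D0 normE] := potential_norm_finite pd; rewrite normE -EFinM.
apply: bigmax_le => [|k k0]; first by rewrite lee_fin !mulr_ge0 ?sqrtr_ge0.
apply: weyl_difference_L2_le k0 _ _ _ _ _ _ D0 _.
- exact: line_height_gt0.
- exact: expR_line_height_le.
- exact: le_line_height.
- exact: potential_square_integrable.
- exact: potential_square_integrable.
- by move=> j; apply: L1norm_potential_le (ltW hr) pq nq.
- by move=> j; apply: L1norm_potential_le (ltW hr) pqt nqt.
- exact: omega_eq_mean0.
- move=> j; rewrite /sqr_L2norm; under eq_Rintegral do rewrite normc_distC.
  by apply: sqr_L2norm_potential_le pd _; rewrite normE.
Qed.
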